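(* Let $K\subset\mathbb C$ be compact and let $L\subset\mathbb C_\infty\setminus K$ be a set containing at least one point from every connected component of $\mathbb C_\infty\setminus K$. Let $R_L$ be the set of rational functions with poles in $L$ (so $R_L\subset O(K)$). Then $R_L$ is dense in $B(K)$.
   Context: $\mathbb C_\infty$ is the Riemann sphere; rational functions in $R_L$ have all their poles in $L$, a pole at $\infty$ being allowed when $\infty\in L$. $\mathbb N_0=\{0,1,2,\dots\}$. For a compact $K\subset\mathbb C$: $A(K)$ is the set of functions $f:K\to\mathbb C$ continuous on $K$ and holomorphic in the interior of $K$. $O(K)$ is the set of functions $f$ holomorphic on some open set $V_f\supseteq K$ (depending on $f$), with the metric $$d(f,g)=\sum_{k=0}^\infty \frac1{2^k}\,\frac{\sup_{z\in K}|f^{(k)}(z)-g^{(k)}(z)|}{1+\sup_{z\in K}|f^{(k)}(z)-g^{(k)}(z)|},$$ where functions agreeing near $K$ are identified. A function $f\in O(K)$ is identified with the sequence $(f^{(k)}|_K)_{k\ge0}\in A(K)^{\mathbb N_0}$. $B(K)$ is the completion of $(O(K),d)$, realized as the set of sequences $(g_k)_{k\ge0}\in A(K)^{\mathbb N_0}$ for which there exist $f_n\in O(K)$ with $\sup_{z\in K}|f_n^{(k)}(z)-g_k(z)|\to0$ as $n\to\infty$ for every $k\in\mathbb N_0$; its metric is given by the same formula $d$ with $f^{(k)},g^{(k)}$ replaced by the $k$-th terms of the sequences (so convergence is uniform convergence on $K$ of each term). *)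

(* Defs.v *)
From HB Require Import structures.
From mathcomp Require Import all_boot all_order all_algebra.
From mathcomp Require Import all_classical all_reals all_analysis.
From mathcomp Require Import complex.

Set Implicit Arguments.
Unset Strict Implicit.
Unset Printing Implicit Defensive.

Import Order.TTheory GRing.Theory Num.Theory.
Import numFieldTopology.Exports numFieldNormedType.Exports.

Local Open Scope classical_set_scope.
Local Open Scope ring_scope.

(* The usual topology and norm of the complex plane: R[i] as a normed module
   over itself, so that [derivable f z 1] and [derive1n] denote complex
   differentiability and complex derivatives. *)
HB.instance Definition _ (R : realType) := NormedModule.copy R[i] R[i]^o.

Definition sphere (R : realType) := one_point_compactification R[i].

Section Spaces.
Context {R : realType}.
Local Notation C := R[i].
Implicit Types (K V : set C) (f : C -> C) (g h : nat -> C -> C).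

Definition sphere_compl K : set (sphere R) := ~` (Some @` K).

Definition holomorphic_on V f := forall z, V z -> derivable f z 1.

(* Functions K -> C are represented by total functions on C, whose values
   outside K are irrelevant: [space_A], [space_B], [supnorm] and [dist] only
   depend on the restrictions to K.  Similarly [space_O] only depends on the
   values near K. *)
Definition space_A K : set (C -> C) :=
  [set f | {within K, continuous f} /\ holomorphic_on (interior K) f].

Definition space_O K : set (C -> C) :=
  [set f | exists V, [/\ open V, K `<=` V & holomorphic_on V f]].

(* The supremum of |f| on K, for f bounded on K; it is 0 if K is empty. *)
Definition supnorm K f : R := sup [set Normc.normc (f z) | z in K].

Definition dist K g h : R :=
  limn (series (fun k : nat =>
    (2 ^+ k)^-1 * (supnorm K (g k \- h k) / (1 + supnorm K (g k \- h k))))).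

Definition jet f : nat -> C -> C := fun k => derive1n k f.

Definition space_B K : set (nat -> C -> C) :=
  [set g | (forall k, space_A K (g k)) /\
    exists f_ : nat -> C -> C, (forall n, space_O K (f_ n)) /\
      forall k, supnorm K (jet (f_ n) k \- g k) @[n --> \oo] --> (0 : R)].

(* The poles of p / q on the sphere, when p and q are coprime. *)
Definition poles (p q : {poly C}) : set (sphere R) :=
  [set w | if w is Some a then root q a : Prop else (size q < size p)%N].

(* The values of p / q at its poles are junk. *)
Definition rational_with_poles_in (L : set (sphere R)) : set (C -> C) :=
  [set f | exists p q : {poly C},
    [/\ q != 0, coprimep p q, poles p q `<=` L & f = fun z => p.[z] / q.[z]]].

Definition dense_in T (d : T -> T -> R) (X D : set T) :=
  D `<=` X /\
  forall x, X x -> forall e : R, 0 < e -> exists2 y, D y & d x y < e.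

End Spaces.

(* Main.v *)
(* Goursat's lemma for squares, proved by bisection and allowing one
   exceptional point, yields Cauchy's formula for squares, hence for the
   boundary of the union of the squares of a fine grid that come close to [K].
   So a function holomorphic near [K] is, near [K], a finite sum of integrals of
   [f(w) / (w - z)] over segments disjoint from [K]; its Taylor coefficients are
   obtained by differentiating under the integral, and Riemann sums approximate
   all of them, up to any given order [N], uniformly on [K] by combinations of
   functions [1 / (w - z)] with [w] outside [K].  The sum of the moduli of the
   first [N + 1] Taylor coefficients is a submultiplicative seminorm at each
   point, so the functions approximable in this seminorm, uniformly on [K], by
   rational functions with poles in [L] form an algebra that is closed under
   geometric series.  Hence the set of points [w] of the sphere for which
   [1 / (w - z)] (or [z] itself, if [w] is infinity) is approximable is relatively
   open and closed in the complement of [K]; as it contains [L], it is the whole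
   complement. *)

Require Import Defs.
From mathcomp Require Import all_boot all_order all_algebra.
From mathcomp Require Import all_classical all_reals all_analysis.
From mathcomp Require Import complex.
From mathcomp Require Import ring lra.

Set Implicit Arguments.
Unset Strict Implicit.
Unset Printing Implicit Defensive.

Import Order.TTheory GRing.Theory Num.Theory.
Import numFieldTopology.Exports numFieldNormedType.Exports.

Local Open Scope classical_set_scope.
Local Open Scope ring_scope.

(** Uniform closeness on [K] does not control derivatives on [K], which may have empty interior, so
    rational approximation in the sup norm does not give density for [dist]. Working on a compact
    neighbourhood of [K] with Cauchy estimates meets another obstacle: a component of the complement
    of [K] may break up there into several, some of which miss [L]. Hence poles are moved relative
    to [K] itself, in a seminorm that already contains the derivatives. Since order [k] has weight
    [2 ^ - k] in the metric, a finite order [N] is enough for each precision; since elements of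
    [B(K)] are limits of elements of [O(K)], it is enough to approximate functions holomorphic near
    [K]. Integrals are limits of dyadic sums, for which halving is exact. Goursat's lemma, the
    primitive of [(w - z)^-2] and the constancy of the winding integral all rest on one principle: a
    quantity additive under bisection that is locally small compared with an additive weight must
    vanish. *)

Local Notation nc := Normc.normc.
Local Notation cRe := complex.Re.
Local Notation cIm := complex.Im.

(** * Complex modulus and the topology of the plane *)

Section ComplexBasics.
Context {R : realType}.
Local Notation C := R[i].
Implicit Types (x y z w : C) (f g : C -> C).

Lemma normCE x : `|x| = (nc x)%:C%C. Proof. by []. Qed.

Lemma nc_ge0 x : 0 <= nc x.
Proof. by case: x => a b; exact: sqrtr_ge0. Qed.

Lemma ncD x y : nc (x + y) <= nc x + nc y.
Proof. by rewrite -lecR rmorphD /= -!normCE ler_normD. Qed.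

Lemma ncN x : nc (- x) = nc x.
Proof. by apply: complexI; rewrite -!normCE normrN. Qed.

Lemma ncB x y : nc (x - y) <= nc x + nc y.
Proof. by rewrite (le_trans (ncD _ _)) // ncN. Qed.

Lemma ncBC x y : nc (x - y) = nc (y - x).
Proof. by rewrite -ncN opprB. Qed.

Lemma ncBd x y : nc x - nc y <= nc (x - y).
Proof. by rewrite lerBlDr; apply: le_trans (ncD _ _); rewrite subrK. Qed.

Lemma ncM x y : nc (x * y) = nc x * nc y. Proof. exact: Normc.normcM. Qed.
Lemma ncV x : nc x^-1 = (nc x)^-1. Proof. exact: Normc.normcV. Qed.
Lemma nc0 : nc (0 : C) = 0. Proof. exact: Normc.normc0. Qed.
Lemma nc1 : nc (1 : C) = 1. Proof. exact: Normc.normc1. Qed.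
Lemma ncX x n : nc (x ^+ n) = nc x ^+ n.
Proof. by elim: n => [|n IH]; rewrite ?expr0 ?nc1// !exprS ncM IH. Qed.
Lemma nc_eq0 x : (nc x == 0) = (x == 0).
Proof. by apply/eqP/eqP => [/Normc.eq0_normc //|->]; exact: nc0. Qed.
Lemma nc_gt0 x : (0 < nc x) = (x != 0).
Proof. by rewrite lt_def nc_ge0 andbT nc_eq0. Qed.

Lemma nc_real (r : R) : nc r%:C%C = `|r|.
Proof. by rewrite /= expr0n addr0 sqrtr_sqr. Qed.

Lemma nc_nat n : nc (n%:R : C) = n%:R.
Proof. by rewrite -(rmorph_nat (real_complex R)) nc_real ger0_norm. Qed.

Lemma nc_sum (I : Type) (r : seq I) (P : pred I) (F : I -> C) :
  nc (\sum_(i <- r | P i) F i) <= \sum_(i <- r | P i) nc (F i).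
Proof.
elim/big_rec2 : _ => [|i y z _ le]; first by rewrite nc0.
by rewrite (le_trans (ncD _ _)) // lerD2l.
Qed.

Lemma Re_le_nc x : `|cRe x| <= nc x.
Proof. by case: x => a b /=; rewrite -sqrtr_sqr ler_wsqrtr // lerDl sqr_ge0. Qed.

Lemma Im_le_nc x : `|cIm x| <= nc x.
Proof. by case: x => a b /=; rewrite -sqrtr_sqr ler_wsqrtr // lerDr sqr_ge0. Qed.

Lemma ReD x y : cRe (x + y) = cRe x + cRe y. Proof. by case: x y => ? ? []. Qed.
Lemma ImD x y : cIm (x + y) = cIm x + cIm y. Proof. by case: x y => ? ? []. Qed.
Lemma ReN x : cRe (- x) = - cRe x. Proof. by case: x. Qed.
Lemma ImN x : cIm (- x) = - cIm x. Proof. by case: x. Qed.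

Lemma nc_le_ReIm x : nc x <= `|cRe x| + `|cIm x|.
Proof.
rewrite {1}(complexE x) (le_trans (ncD _ _)) // ncM !nc_real.
by rewrite (_ : nc 'i%C = 1) ?mul1r //= expr0n expr1n add0r sqrtr1.
Qed.

(** The norm of [C] takes its values in [C], and so do the radii of balls; a positive complex number
    is real, which gives back real radii. *)
Lemma nbhsCP z (P : set C) :
  nbhs z P <-> exists2 e : R, 0 < e & forall y, nc (y - z) < e -> P y.
Proof.
split.
  move=> /nbhs_ballP[e e0 eP].
  have e1 : e = (cRe e)%:C%C.
    have : 0 < e by exact: e0.
    by rewrite ltcE /= => /andP[/eqP]; case: (e) => a b /= ->.
  exists (cRe e); first by rewrite -ltcR -e1.
  by move=> y yz; apply: eP; rewrite -ball_normE /= distrC normCE e1 ltcR.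
move=> [e e0 eP]; apply/nbhs_ballP; exists e%:C%C => /=; first by rewrite ltcR.
by move=> y; rewrite -ball_normE /= distrC normCE ltcR => /eP.
Qed.

Lemma cvgCP (T : Type) (F : set_system T) (FF : Filter F) (f : T -> C) (l : C) :
  (f @ F --> l) <-> forall e : R, 0 < e -> \forall x \near F, nc (f x - l) < e.
Proof.
split=> [h e e0|h A /nbhsCP[e e0 eA]].
  by apply: (h [set y | nc (y - l) < e]); apply/nbhsCP; exists e.
by apply: filterS (h _ e0) => x; exact: eA.
Qed.

Lemma contCP f z : {for z, continuous f} <->
  forall e : R, 0 < e -> exists2 d : R, 0 < d & forall y, nc (y - z) < d -> nc (f y - f z) < e.
Proof.
split=> h.
  by move=> e e0; have /nbhsCP := (cvgCP (nbhs_filter z) f (f z)).1 h e e0.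
by apply/(cvgCP (nbhs_filter z) f (f z)) => e e0; apply/nbhsCP; exact: h.
Qed.

(** Without a quotient, the point [y = z] need not be excluded. The price is a weak inequality,
    hence the [e / 2] in the converse. *)
Lemma is_deriveCP f z (d : C) : is_derive z 1 f d <->
  forall e : R, 0 < e -> exists2 r : R, 0 < r & forall y, nc (y - z) < r ->
    nc (f y - f z - d * (y - z)) <= e * nc (y - z).
Proof.
have key : (fun h : C => h^-1 *: ((f \o shift z) (h *: 1) - f z)) @ 0^' --> d <->
  forall e : R, 0 < e -> exists2 r : R, 0 < r & forall y, nc (y - z) < r ->
    nc (f y - f z - d * (y - z)) <= e * nc (y - z).
  rewrite (cvgCP (dnbhs_filter (0 : C))); split=> h e e0.
    have /nbhsCP[r r0 hr] := h e e0.
    exists r => // y yz; have [->|yz0] := eqVneq y z.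
      by rewrite !subrr mulr0 subrr nc0 mulr0.
    have yz1 : y - z != 0 by rewrite subr_eq0.
    have := hr (y - z); rewrite subr0 => /(_ yz yz1) /ltW /=.
    rewrite /GRing.scale /= mulr1 subrK => hh.
    rewrite -[X in X <= _](_ : nc ((y - z)^-1 * (f y - f z) - d) * nc (y - z) = _).
      by rewrite ler_wpM2r // nc_ge0.
    by rewrite -ncM mulrBl mulrAC mulVf // mul1r.
  have [r r0 hr] := h (e / 2) (divr_gt0 e0 (ltr0Sn _ 1)).
  apply/nbhsCP; exists r => // y; rewrite subr0 => yr y0.
  rewrite /GRing.scale /= mulr1.
  have := hr (y + z); rewrite addrK => /(_ yr) hh.
  have y1 : 0 < nc y by rewrite nc_gt0.
  rewrite -(ltr_pM2r y1) -ncM mulrBl mulrAC mulVf // mul1r.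
  by apply: le_lt_trans hh _; rewrite ltr_pM2r // ltr_pdivrMr // ltr_pMr // ltr1n.
rewrite -key; split=> [[df <-]|h]; first exact: df.
by apply: DeriveDef; [apply/cvg_ex; exists d|exact: cvg_lim].
Qed.

End ComplexBasics.

(** * Integration over [0, 1] *)

Section DyadicIntegral.
Context {R : realType}.
Local Notation C := R[i].
Implicit Types (phi psi : R -> C) (m n : nat).

(* Left Riemann sums over [2 ^ m] equal subintervals of [0, 1], in a recursive
   form that makes halving the interval definitional. *)
Fixpoint dsum (phi : R -> C) (m : nat) : C :=
  if m is m'.+1 then
    (dsum (fun t => phi (t / 2)) m' + dsum (fun t => phi ((1 + t) / 2)) m') / 2
  else phi 0.

Lemma half_in01 (t : R) : 0 <= t <= 1 ->
  (0 <= t / 2 <= 1) /\ (0 <= (1 + t) / 2 <= 1).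
Proof. by move=> /andP[? ?]; split; lra. Qed.

Lemma dsumD phi psi m : dsum (fun t => phi t + psi t) m = dsum phi m + dsum psi m.
Proof. by elim: m phi psi => //= m IH phi psi; rewrite !IH; ring. Qed.

Lemma dsumZ (a : C) phi m : dsum (fun t => a * phi t) m = a * dsum phi m.
Proof. by elim: m phi => //= m IH phi; rewrite !IH; ring. Qed.

Lemma dsum_cst (a : C) m : dsum (fun=> a) m = a.
Proof. by elim: m => //= m ->; field. Qed.

Lemma eq_dsum phi psi m : (forall t : R, 0 <= t <= 1 -> phi t = psi t) ->
  dsum phi m = dsum psi m.
Proof.
elim: m phi psi => [|m IH] phi psi e /=; first by apply: e; rewrite lexx ler01.
by congr ((_ + _) / 2); apply: IH => t /half_in01[? ?]; exact: e.
Qed.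

(** A dyadic sum is an iterated midpoint of values of [phi], so it stays in every midpoint-convex
    set that contains them. *)
Lemma dsum_convex (P : C -> Prop) phi m :
  (forall x y, P x -> P y -> P ((x + y) / 2)) ->
  (forall t : R, 0 <= t <= 1 -> P (phi t)) -> P (dsum phi m).
Proof.
move=> hP; elim: m phi => [|m IH] phi h /=; first by apply: h; rewrite lexx ler01.
by apply: hP; apply: IH => t /half_in01[? ?]; exact: h.
Qed.

Lemma nc_half (x : C) : nc (x / 2) = nc x / 2.
Proof. by rewrite ncM ncV nc_nat. Qed.

Lemma dsum_le phi m (M : R) :
  (forall t : R, 0 <= t <= 1 -> nc (phi t) <= M) -> nc (dsum phi m) <= M.
Proof.
move=> h; apply: (dsum_convex (P := fun x => nc x <= M)) => // x y hx hy.
by rewrite nc_half; have := ncD x y; lra.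
Qed.

(** The induction is on the coarse level [n]: each half of [phi], rescaled to [0, 1], satisfies the
    hypothesis one level lower. At level 0 all values are within [e] of [phi 0]. *)
Lemma dsum_osc phi m n (e : R) :
  (forall s t, 0 <= s <= 1 -> 0 <= t <= 1 -> `|s - t| <= 2^-1 ^+ n ->
     nc (phi s - phi t) <= e) ->
  nc (dsum phi (n + m) - dsum phi n) <= e.
Proof.
elim: n phi => [|n IH] phi h.
  rewrite add0n /=.
  rewrite -[X in nc (_ - X)](dsum_cst (phi 0) m) -[X in _ - X]mul1r -mulNr -dsumZ.
  rewrite -dsumD; apply: dsum_le => t t01; rewrite mulN1r; apply: h => //.
    by rewrite lexx ler01.
  by rewrite expr0 subr0; case/andP: t01 => *; rewrite ger0_norm.
rewrite addSn /= -mulrBl nc_half.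
rewrite opprD addrACA.
have aux u : (forall t : R, 0 <= t <= 1 -> 0 <= u t <= 1) ->
   (forall s t, u s - u t = (s - t) / 2) ->
   nc (dsum (fun t => phi (u t)) (n + m) - dsum (fun t => phi (u t)) n) <= e.
  move=> hu hu2; apply: IH => s t s01 t01 st; apply: h; rewrite ?hu //.
  by rewrite hu2 normrM [X in _ * X]ger0_norm ?invr_ge0 // exprSr ler_wpM2r // invr_ge0.
have h1 := aux (fun t => t / 2) (fun t ht => (half_in01 ht).1)
  (fun s t => esym (mulrBl _ _ _)).
have h2 := aux (fun t => (1 + t) / 2) (fun t ht => (half_in01 ht).2).
have {}h2 := h2 (fun s t => ltac:(by rewrite -mulrBl; congr (_ / _); ring)).
by apply: le_trans (ler_wpM2r _ (ncD _ _)) _; [rewrite invr_ge0|lra].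
Qed.

(** The point [s] ranges over a full neighbourhood in [R], even at the end points, so that limit
    rules apply without subspace topologies. *)
Definition cont01 phi := forall t : R, 0 <= t <= 1 ->
  forall e : R, 0 < e -> exists2 d : R, 0 < d &
    forall s, `|s - t| < d -> nc (phi s - phi t) < e.

(** A Lebesgue number principle: a property that holds near each point for all small scales holds at
    a common scale. It yields uniform continuity, distances to open sets and, with [_ <= d^-1] as
    the property, boundedness. *)
Lemma compact_lebesgue (X : topologicalType) (A : set X) (P : R -> X -> Prop) :
  compact A ->
  (forall x, A x -> exists2 d : R, 0 < d & \forall y \near x, forall e, 0 < e -> e < d -> P e y) ->
  exists2 d : R, 0 < d & forall x, A x -> P d x.
Proof.
move=> cA h.
have := (@compact_near_coveringP _ A).1 cA _ (0 : R)^'+ P _ => H.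
have : \forall e \near (0 : R)^'+, A `<=` P e.
  apply: H => x /h[d d0 hd].
  exists ([set y | forall e, 0 < e -> e < d -> P e y], [set e | 0 < e < d]) => /=.
    split => //.
    near=> e; apply/andP; split; near: e; first exact: nbhs_right_gt.
    exact: nbhs_right_lt.
  by move=> [y e] [/= yh /andP[e0 ed]]; exact: yh.
move=> /(filterI (nbhs_right_gt (0:R))) /filter_ex[d /= [d0 hd]].
by exists d.
Unshelve. all: by end_near. Qed.

Lemma compact_lebesgue01 (P : R -> R -> Prop) :
  (forall t : R, 0 <= t <= 1 -> exists2 d : R, 0 < d & forall s e,
     `|s - t| < d -> 0 < e -> e < d -> P e s) ->
  exists2 d : R, 0 < d & forall t : R, 0 <= t <= 1 -> P d t.
Proof.
move=> h; have [t|d d0 hd] := compact_lebesgue (P := P) (@segment_compact R 0 1).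
  rewrite /= in_itv /= => /h[d d0 hd]; exists d => //.
  apply/nbhs_ballP; exists d => // s st e; apply: hd.
  by move: st; rewrite /ball /= distrC.
by exists d => // t t01; apply: hd; rewrite /= in_itv.
Qed.

Lemma cont01_unif phi (e : R) : cont01 phi -> 0 < e -> exists2 d : R, 0 < d &
  forall s t, 0 <= s <= 1 -> 0 <= t <= 1 -> `|s - t| <= d -> nc (phi s - phi t) <= e.
Proof.
move=> cphi e0.
have [t t01|d d0 hd] := @compact_lebesgue01
    (fun d t => forall s, `|s - t| <= d -> nc (phi s - phi t) <= e).
  have [d d0 hd] := cphi t t01 (e / 2) (divr_gt0 e0 (ltr0Sn _ 1)).
  exists (d / 2); first by rewrite divr_gt0.
  move=> s d' sd d'0 d'd s' s's.
  have h1 := hd s ltac:(lra).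
  have h2 := hd s' ltac:(by have := ler_distD s s' t; lra).
  rewrite (_ : phi s' - phi s = (phi s' - phi t) - (phi s - phi t)); last by ring.
  by have := ncB (phi s' - phi t) (phi s - phi t); lra.
by exists d => // s t _ t01; exact: hd.
Qed.

Lemma half_small (d : R) : 0 < d -> exists n, 2^-1 ^+ n <= d.
Proof.
move=> d0; have : (fun n => 2^-1 ^+ n : R) @ \oo --> (0 : R).
  by apply: cvg_expr; rewrite ger0_norm; lra.
move=> /cvgrPdist_le /(_ _ d0) [n _ /(_ n (leqnn n))]; rewrite sub0r normrN.
by rewrite ger0_norm ?exprn_ge0 ?invr_ge0 // => ?; exists n.
Qed.

(** * The integral as limit of dyadic sums, and its rules *)

Definition is_int phi (l : C) := forall e : R, 0 < e ->
  exists n, forall m, (n <= m)%N -> nc (dsum phi m - l) <= e.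

Definition int01 phi : C := xget 0 [set l | is_int phi l].

Lemma real_cauchy (u : nat -> R) :
  (forall e, 0 < e -> exists n, forall m, (n <= m)%N -> `|u m - u n| <= e) ->
  exists l, forall e, 0 < e -> exists n, forall m, (n <= m)%N -> `|u m - l| <= e.
Proof.
move=> h; have : cauchy (u @ \oo).
  apply: cauchy_exP => e e0; have [n hn] := h (e / 2) (divr_gt0 e0 (ltr0Sn _ 1)).
  exists (u n); exists n => // m /= nm; have := hn m nm.
  by rewrite /ball /= distrC; lra.
move=> /cauchy_cvgP/cvg_ex[l /cvgrPdist_le ul]; exists l => e e0.
by have [n _ hn] := ul e e0; exists n => m nm; rewrite distrC; exact: hn.
Qed.

Lemma is_int_ex phi : cont01 phi -> exists l, is_int phi l.
Proof.
move=> cphi.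
have cau e : 0 < e -> exists n, forall m, (n <= m)%N -> nc (dsum phi m - dsum phi n) <= e.
  move=> e0; have [d d0 hd] := cont01_unif cphi e0.
  have [n hn] := half_small d0; exists n => m nm.
  rewrite -(subnKC nm); apply: dsum_osc => s t s01 t01 st.
  by apply: hd => //; exact: le_trans hn.
have [|a ha] := @real_cauchy (fun m => cRe (dsum phi m)).
  move=> e /cau[n hn]; exists n => m /hn; apply: le_trans.
  by rewrite -ReN -ReD Re_le_nc.
have [|b hb] := @real_cauchy (fun m => cIm (dsum phi m)).
  move=> e /cau[n hn]; exists n => m /hn; apply: le_trans.
  by rewrite -ImN -ImD Im_le_nc.
exists (Complex a b) => e e0.
have [n1 h1] := ha (e / 2) (divr_gt0 e0 (ltr0Sn _ 1)).
have [n2 h2] := hb (e / 2) (divr_gt0 e0 (ltr0Sn _ 1)).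
exists (maxn n1 n2) => m; rewrite geq_max => /andP[/h1 l1 /h2 l2].
apply: le_trans (nc_le_ReIm _) _; rewrite ReD ImD ReN ImN /=.
by lra.
Qed.

Lemma le_eps (x y : R) : (forall e, 0 < e -> x <= y + e) -> x <= y.
Proof. by move=> h; apply/ler_addgt0Pr. Qed.

Lemma is_int_uniq phi l l' : is_int phi l -> is_int phi l' -> l = l'.
Proof.
move=> h h'; apply/eqP; rewrite -subr_eq0 -nc_eq0 eq_le nc_ge0 andbT.
apply: le_eps => e e0.
have [n hn] := h (e / 2) (divr_gt0 e0 (ltr0Sn _ 1)).
have [n' hn'] := h' (e / 2) (divr_gt0 e0 (ltr0Sn _ 1)).
have := hn _ (leq_maxl n n'); have := hn' _ (leq_maxr n n').
set u := dsum _ _ => a b.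
rewrite (_ : l - l' = (u - l') - (u - l)); last by ring.
by have := ncB (u - l') (u - l); lra.
Qed.

Lemma int01_eq phi l : is_int phi l -> int01 phi = l.
Proof.
move=> h; apply: (is_int_uniq _ (h)).
by rewrite /int01; case: xgetP => [x -> //|H]; case: (H l).
Qed.

Lemma int01P phi : cont01 phi -> is_int phi (int01 phi).
Proof. by move=> /is_int_ex[l hl]; rewrite (int01_eq hl). Qed.

Lemma eq_int01 phi psi : (forall t : R, 0 <= t <= 1 -> phi t = psi t) ->
  int01 phi = int01 psi.
Proof.
move=> h; rewrite /int01; congr (xget _ _); apply/funext => l; apply/propext.
by split=> H e /H[n hn]; exists n => m /hn; rewrite (eq_dsum _ h).
Qed.

Lemma int01_closed phi (A : C -> Prop) : cont01 phi ->
  (forall l, (forall e : R, 0 < e -> exists2 x, A x & nc (x - l) <= e) -> A l) ->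
  (forall m, A (dsum phi m)) -> A (int01 phi).
Proof.
move=> /int01P h cA hA; apply: cA => e /h[n /(_ n (leqnn n)) hn].
by exists (dsum phi n).
Qed.

Lemma int01D phi psi : cont01 phi -> cont01 psi ->
  int01 (fun t => phi t + psi t) = int01 phi + int01 psi.
Proof.
move=> /int01P h /int01P h'; apply: int01_eq => e e0.
have [n hn] := h (e / 2) (divr_gt0 e0 (ltr0Sn _ 1)).
have [n' hn'] := h' (e / 2) (divr_gt0 e0 (ltr0Sn _ 1)).
exists (maxn n n') => m; rewrite geq_max => /andP[/hn a /hn' b].
rewrite dsumD opprD addrACA; apply: le_trans (ncD _ _) _; lra.
Qed.

Lemma int01Z (a : C) phi : cont01 phi -> int01 (fun t => a * phi t) = a * int01 phi.
Proof.
move=> /int01P h; apply: int01_eq => e e0.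
have a0 : 0 < nc a + 1 by have := nc_ge0 a; lra.
have [n hn] := h (e / (nc a + 1)) (divr_gt0 e0 a0).
exists n => m /hn; rewrite dsumZ -mulrBr ncM => hm.
apply: le_trans (_ : (nc a + 1) * (e / (nc a + 1)) <= e).
  by apply: ler_pM; rewrite ?nc_ge0 //; lra.
by rewrite mulrC divfK // gt_eqF.
Qed.

Lemma int01_cst (a : C) : int01 (fun=> a) = a.
Proof. by apply: int01_eq => e e0; exists 0%N => m _; rewrite dsum_cst subrr nc0 ltW. Qed.

(** The error depends only on the oscillation at the scale of the subdivision. For an integrand with
    a parameter, an oscillation bound uniform in the parameter thus makes the Riemann sums converge
    uniformly. *)
Lemma int01_dsum phi n (e : R) : cont01 phi ->
  (forall s t, 0 <= s <= 1 -> 0 <= t <= 1 -> `|s - t| <= 2^-1 ^+ n ->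
     nc (phi s - phi t) <= e) -> nc (int01 phi - dsum phi n) <= e.
Proof.
move=> /int01P h osc; apply: le_eps => r /h[k hk].
have := hk (n + k)%N (leq_addl _ _); have := dsum_osc k osc.
set u := dsum _ (n + k); set v := dsum _ n; set l := int01 _ => a b.
rewrite (_ : l - v = (u - v) - (u - l)); last by ring.
by have := ncB (u - v) (u - l); lra.
Qed.

Lemma int01_le phi (M : R) : cont01 phi ->
  (forall t : R, 0 <= t <= 1 -> nc (phi t) <= M) -> nc (int01 phi) <= M.
Proof.
move=> cphi h; apply: (int01_closed (A := fun x => nc x <= M)) => //.
  move=> l hl; apply: le_eps => e /hl[x xM xl].
  by have := ncBd l x; rewrite ncBC; lra.
by move=> m; exact: dsum_le.
Qed.

(** Serves to show that the constant [cpi] of Cauchy's formula is not zero. *)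
Lemma int01_Im_ge phi (c : R) : cont01 phi ->
  (forall t : R, 0 <= t <= 1 -> c <= cIm (phi t)) -> c <= cIm (int01 phi).
Proof.
move=> cphi h; apply: (int01_closed (A := fun x => c <= cIm x)) => //.
  move=> l hl; apply: le_eps => e /hl[x xM xl].
  have := Im_le_nc (x - l); rewrite ImD ImN => /ler_normlP[]; lra.
move=> m; apply: (dsum_convex (P := fun x => c <= cIm x)) => // x y hx hy.
rewrite (_ : (2 : C)^-1 = (2^-1 : R)%:C%C); last first.
  by rewrite fmorphV /= rmorphMn.
by case: x y hx hy => [a b] [a' b'] /=; rewrite mulr0 add0r; lra.
Qed.

Lemma cont01_half phi : cont01 phi ->
  cont01 (fun t => phi (t / 2)) /\ cont01 (fun t => phi ((1 + t) / 2)).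
Proof.
move=> cphi; split=> t /half_in01[t1 t2] e e0.
  have [d d0 hd] := cphi _ t1 e e0; exists d => // s st; apply: hd.
  by rewrite -mulrBl normrM [`|2^-1|]ger0_norm ?invr_ge0 //; have := normr_ge0 (s - t); lra.
have [d d0 hd] := cphi _ t2 e e0; exists d => // s st; apply: hd.
rewrite -mulrBl normrM [`|2^-1|]ger0_norm ?invr_ge0 //.
rewrite (_ : 1 + s - (1 + t) = s - t); last by ring.
by have := normr_ge0 (s - t); lra.
Qed.

Lemma int01_half phi : cont01 phi -> int01 phi =
  (int01 (fun t => phi (t / 2)) + int01 (fun t => phi ((1 + t) / 2))) / 2.
Proof.
move=> cphi; have [/int01P h /int01P h'] := cont01_half cphi.
apply: int01_eq => e e0.
have [n hn] := h e e0; have [n' hn'] := h' e e0.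
exists (maxn n n').+1 => -[//|m]; rewrite ltnS geq_max => /andP[/hn a /hn' b].
rewrite /= -mulrBl nc_half opprD addrACA.
by apply: le_trans (ler_wpM2r _ (ncD _ _)) _; [rewrite invr_ge0|lra].
Qed.

Lemma cont01_cst (a : C) : cont01 (fun=> a).
Proof. by move=> t _ e e0; exists 1 => // s _; rewrite subrr nc0. Qed.

Lemma cont01P phi : cont01 phi <->
  forall t : R, 0 <= t <= 1 -> phi @ t --> phi t.
Proof.
split=> h t t01.
  apply/(cvgCP (nbhs_filter t)) => e /(h t t01)[d d0 hd].
  by apply/nbhs_ballP; exists d => // s /=; rewrite /ball /= distrC => /hd.
move=> e e0; have /nbhs_ballP[d d0 hd] := (cvgCP (nbhs_filter t) _ _).1 (h t t01) e e0.
by exists d => // s st; apply: hd; rewrite /ball /= distrC.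
Qed.

Lemma cont01D phi psi : cont01 phi -> cont01 psi -> cont01 (fun t => phi t + psi t).
Proof.
by move=> /cont01P h /cont01P h'; apply/cont01P => t t01; apply: cvgD; [exact: h|exact: h'].
Qed.

Lemma cont01M phi psi : cont01 phi -> cont01 psi -> cont01 (fun t => phi t * psi t).
Proof.
by move=> /cont01P h /cont01P h'; apply/cont01P => t t01; apply: cvgM; [exact: h|exact: h'].
Qed.

Lemma cont01V phi : cont01 phi -> (forall t : R, 0 <= t <= 1 -> phi t != 0) ->
  cont01 (fun t => (phi t)^-1).
Proof.
by move=> /cont01P h h'; apply/cont01P => t t01; apply: cvgV; [exact: h'|exact: h].
Qed.

Lemma cont01N phi : cont01 phi -> cont01 (fun t => - phi t).
Proof. by move=> /cont01P h; apply/cont01P => t t01; apply: cvgN; exact: h. Qed.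

Lemma cont01B phi psi : cont01 phi -> cont01 psi -> cont01 (fun t => phi t - psi t).
Proof. by move=> h h'; apply: cont01D => //; exact: cont01N. Qed.

Lemma cont01X phi n : cont01 phi -> cont01 (fun t => phi t ^+ n).
Proof.
move=> h; elim: n => [|n IH]; first exact: cont01_cst.
rewrite (_ : (fun t => _) = fun t => phi t * phi t ^+ n); first exact: cont01M.
by apply/funext => t; rewrite exprS.
Qed.

Lemma cont01_id : cont01 (fun t => t%:C%C).
Proof. by move=> t _ e e0; exists e => // s; rewrite -rmorphB nc_real. Qed.

Lemma cont01_comp (f : C -> C) phi : cont01 phi ->
  (forall t : R, 0 <= t <= 1 -> {for phi t, continuous f}) -> cont01 (fun t => f (phi t)).
Proof.
move=> h hf t t01 e e0; have [d d0 hd] := (contCP f (phi t)).1 (hf t t01) e e0.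
by have [r r0 hr] := h t t01 d d0; exists r => // s /hr /hd.
Qed.

Lemma int01N phi : cont01 phi -> int01 (fun t => - phi t) = - int01 phi.
Proof.
move=> h; rewrite -mulN1r -int01Z //; congr int01; apply/funext => t.
by rewrite mulN1r.
Qed.

Lemma int01B phi psi : cont01 phi -> cont01 psi ->
  int01 (fun t => phi t - psi t) = int01 phi - int01 psi.
Proof. by move=> h h'; rewrite int01D ?int01N //; exact: cont01N. Qed.

End DyadicIntegral.

(** * Goursat's lemma *)

Section Goursat.
Context {R : realType}.
Local Notation C := R[i].
Implicit Types (h f g : C -> C) (a b z w : C) (s t u v : R).

(** The contour integral from [a] to [a + b]: [b] is the displacement, not the end point. *)
Definition seg h a b : C := b * int01 (fun t => h (a + t%:C%C * b)).

(** For [b] real and positive, the positively oriented boundary of the square with lower left corner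
    [a]: bottom and right, minus top and left. *)
Definition oint h a b : C :=
  seg h a b + seg h (a + b) ('i%C * b) - seg h (a + 'i%C * b) b - seg h a ('i%C * b).

Definition contseg h a b := cont01 (fun t => h (a + t%:C%C * b)).

Definition csq a s : set C :=
  [set w | (cRe a <= cRe w <= cRe a + s) /\ (cIm a <= cIm w <= cIm a + s)].

Lemma real_half (s : R) : (s / 2)%:C%C = s%:C%C / 2.
Proof. by rewrite rmorphM /= fmorphV /= rmorphMn. Qed.

Lemma real_D (s t : R) : (s + t)%:C%C = s%:C%C + t%:C%C.
Proof. exact: rmorphD. Qed.

Lemma seg_halfE h a b :
  (fun t => h (a + (t / 2)%:C%C * b)) = (fun t => h (a + t%:C%C * (b / 2))) /\
  (fun t => h (a + ((1 + t) / 2)%:C%C * b)) =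
  (fun t => h (a + b / 2 + t%:C%C * (b / 2))).
Proof.
have e0 : 2 != 0 :> C by rewrite pnatr_eq0.
by split; apply/funext => t; congr h; rewrite real_half ?real_D; field.
Qed.

Lemma seg_half h a b : contseg h a b ->
  seg h a b = seg h a (b / 2) + seg h (a + b / 2) (b / 2).
Proof.
move=> ch; rewrite /seg (int01_half ch).
have [-> ->] := seg_halfE h a b.
by rewrite -mulrDr [RHS]mulrAC mulrA.
Qed.

Lemma segD f g a b : contseg f a b -> contseg g a b ->
  seg (fun w => f w + g w) a b = seg f a b + seg g a b.
Proof. by move=> cf cg; rewrite /seg int01D // mulrDr. Qed.

Lemma segZ (c : C) f a b : contseg f a b ->
  seg (fun w => c * f w) a b = c * seg f a b.
Proof. by move=> cf; rewrite /seg int01Z // mulrCA. Qed.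

Lemma seg_le h a b (M : R) : contseg h a b ->
  (forall t, 0 <= t <= 1 -> nc (h (a + t%:C%C * b)) <= M) ->
  nc (seg h a b) <= nc b * M.
Proof. by move=> ch hM; rewrite ncM ler_wpM2l ?nc_ge0 // int01_le. Qed.

Lemma eq_seg f g a b :
  (forall t, 0 <= t <= 1 -> f (a + t%:C%C * b) = g (a + t%:C%C * b)) ->
  seg f a b = seg g a b.
Proof. by move=> fg; rewrite /seg (eq_int01 fg). Qed.

(** The boundary of [csq a s]. Integrands with a singularity inside the square are continuous only
    there, so the rules for [oint] ask for no more. *)
Definition sqb a s : set C := [set w | csq a s w /\
  [\/ cRe w = cRe a, cRe w = cRe a + s, cIm w = cIm a | cIm w = cIm a + s]].

Lemma sqb_edges a s t : 0 <= s -> 0 <= t <= 1 ->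
  [/\ sqb a s (a + t%:C%C * s%:C%C), sqb a s (a + s%:C%C + t%:C%C * ('i%C * s%:C%C)),
    sqb a s (a + 'i%C * s%:C%C + t%:C%C * s%:C%C) & sqb a s (a + t%:C%C * ('i%C * s%:C%C))].
Proof.
move=> s0 /andP[t0 t1]; have ts0 : 0 <= t * s by rewrite mulr_ge0.
have ts1 : t * s <= s by rewrite ler_piMl.
case: a => x y; split; (split; first by split; rewrite /= ?simpm /=; apply/andP; split; lra).
- by apply: Or43; rewrite /=; ring.
- by apply: Or42; rewrite /=; ring.
- by apply: Or44; rewrite /=; ring.
- by apply: Or41; rewrite /=; ring.
Qed.

Definition contsq h a s := forall w, csq a s w -> {for w, continuous h}.
Definition contb h a s := forall w, sqb a s w -> {for w, continuous h}.

Lemma contsqb h a s : contsq h a s -> contb h a s.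
Proof. by move=> ch w [/ch]. Qed.

Lemma contsqD f g a s : contsq f a s -> contsq g a s -> contsq (fun w => f w + g w) a s.
Proof. by move=> cf cg w wQ; exact: (continuousD (cf w wQ) (cg w wQ)). Qed.

Lemma contsq_cst (c : C) a s : contsq (fun=> c) a s.
Proof. by move=> w _; exact: cst_continuous. Qed.

Lemma contsqZ (c : C) a s : contsq (fun w => c * w) a s.
Proof.
move=> w _; apply/contCP => e e0; have c0 : 0 < nc c + 1 by have := nc_ge0 c; lra.
exists (e / (nc c + 1)); first by rewrite divr_gt0.
move=> y; rewrite -mulrBr ncM ltr_pdivlMr // => h; apply: le_lt_trans h.
by rewrite mulrC ler_wpM2l ?nc_ge0 //; lra.
Qed.

Lemma contseg_cont h a b : (forall t, 0 <= t <= 1 -> {for a + t%:C%C * b, continuous h}) ->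
  contseg h a b.
Proof.
move=> ch; apply: (cont01_comp (f := h)) => //.
apply: cont01D; first exact: cont01_cst.
by apply: cont01M; [exact: cont01_id|exact: cont01_cst].
Qed.

Lemma contb_seg h a s : 0 <= s -> contb h a s ->
  [/\ contseg h a s%:C%C, contseg h (a + s%:C%C) ('i%C * s%:C%C),
    contseg h (a + 'i%C * s%:C%C) s%:C%C & contseg h a ('i%C * s%:C%C)].
Proof.
move=> s0 ch; split; apply: contseg_cont => t t01; apply: ch;
  by have [] := sqb_edges a s0 t01.
Qed.

Lemma ointD f g a s : 0 <= s -> contb f a s -> contb g a s ->
  oint (fun w => f w + g w) a s%:C%C = oint f a s%:C%C + oint g a s%:C%C.
Proof.
move=> s0 /(contb_seg s0)[f1 f2 f3 f4] /(contb_seg s0)[g1 g2 g3 g4].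
by rewrite /oint !segD //; ring.
Qed.

Lemma ointZ (c : C) f a s : 0 <= s -> contb f a s ->
  oint (fun w => c * f w) a s%:C%C = c * oint f a s%:C%C.
Proof.
move=> s0 /(contb_seg s0)[f1 f2 f3 f4].
by rewrite /oint !segZ //; ring.
Qed.

Lemma eq_oint f g a s : 0 <= s -> (forall w, sqb a s w -> f w = g w) ->
  oint f a s%:C%C = oint g a s%:C%C.
Proof.
move=> s0 fg; rewrite /oint.
by congr (_ + _ - _ - _); apply: eq_seg => t /(sqb_edges a s0)[? ? ? ?]; exact: fg.
Qed.

Lemma nc_i : nc 'i%C = 1 :> R.
Proof. by rewrite /= expr0n expr1n add0r sqrtr1. Qed.

Lemma oint_le h a s (M : R) : 0 <= s -> contb h a s ->
  (forall w, sqb a s w -> nc (h w) <= M) -> nc (oint h a s%:C%C) <= 4 * s * M.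
Proof.
move=> s0 /(contb_seg s0)[h1 h2 h3 h4] hM; rewrite /oint.
have e t t01 := sqb_edges a (t := t) s0 t01.
have l1 := seg_le h1 (fun t t01 => let: And4 x _ _ _ := e t t01 in hM _ x).
have l2 := seg_le h2 (fun t t01 => let: And4 _ x _ _ := e t t01 in hM _ x).
have l3 := seg_le h3 (fun t t01 => let: And4 _ _ x _ := e t t01 in hM _ x).
have l4 := seg_le h4 (fun t t01 => let: And4 _ _ _ x := e t t01 in hM _ x).
move: l1 l2 l3 l4; rewrite ncM nc_i mul1r nc_real ger0_norm // => l1 l2 l3 l4.
have := ncB (seg h a s%:C%C + seg h (a + s%:C%C) ('i%C * s%:C%C) - seg h (a + 'i%C * s%:C%C) s%:C%C) (seg h a ('i%C * s%:C%C)).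
have := ncB (seg h a s%:C%C + seg h (a + s%:C%C) ('i%C * s%:C%C)) (seg h (a + 'i%C * s%:C%C) s%:C%C).
have := ncD (seg h a s%:C%C) (seg h (a + s%:C%C) ('i%C * s%:C%C)).
by lra.
Qed.

(** The inner sides of the four quarters are traversed twice, in opposite directions, and cancel. *)
Lemma oint_split h a s : 0 <= s -> contsq h a s ->
  oint h a s%:C%C =
  oint h a (s / 2)%:C%C + oint h (a + (s / 2)%:C%C) (s / 2)%:C%C +
  oint h (a + 'i%C * (s / 2)%:C%C) (s / 2)%:C%C +
  oint h (a + (s / 2)%:C%C + 'i%C * (s / 2)%:C%C) (s / 2)%:C%C.
Proof.
move=> s0 /contsqb/(contb_seg s0)[h1 h2 h3 h4].
rewrite real_half /oint (seg_half h1) (seg_half h2) (seg_half h3) (seg_half h4).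
have e0 : 2 != 0 :> C by rewrite pnatr_eq0.
set b := s%:C%C.
have -> : 'i%C * b / 2 = 'i%C * (b / 2) by rewrite mulrA.
have e1 : a + b = a + b / 2 + b / 2 by field.
have e2 : a + 'i%C * b = a + 'i%C * (b / 2) + 'i%C * (b / 2) by field.
rewrite e1 e2.
have -> : a + 'i%C * (b / 2) + 'i%C * (b / 2) + b / 2 = a + b / 2 + 'i%C * (b / 2) + 'i%C * (b / 2) by ring.
have -> : a + 'i%C * (b / 2) + b / 2 = a + b / 2 + 'i%C * (b / 2) by ring.
have -> : a + b / 2 + b / 2 + 'i%C * (b / 2) = a + b / 2 + 'i%C * (b / 2) + b / 2 by ring.
ring.
Qed.

(** On each side the integral is explicit in terms of the integral of [t] over [0, 1], whose
    contributions cancel between opposite sides. *)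
Lemma oint_affine (al be : C) w0 a b : oint (fun w => al + be * (w - w0)) a b = 0.
Proof.
have E a' b' : seg (fun w => al + be * (w - w0)) a' b' =
    b' * (al + be * (a' - w0) + be * b' * int01 (fun t => t%:C%C)).
  rewrite /seg; congr (_ * _).
  rewrite -int01Z; last exact: cont01_id.
  rewrite -[X in X + _](int01_cst (al + be * (a' - w0))) -int01D; last 2 first.
  - exact: cont01_cst.
  - by apply: cont01M; [exact: cont01_cst|exact: cont01_id].
  by congr int01; apply/funext => t; ring.
by rewrite /oint !E; ring.
Qed.

(** * Bisection of squares and Goursat's estimate *)

Lemma nested_halving (x : nat -> R) s : 0 <= s ->
  (forall n, x n <= x n.+1 /\ x n.+1 + s / 2 ^+ n.+1 <= x n + s / 2 ^+ n) ->
  exists l, forall n, x n <= l <= x n + s / 2 ^+ n.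
Proof.
move=> s0 hx.
have incr n m : x n <= x (n + m)%N.
  by elim: m => [|m IH]; rewrite ?addn0 // addnS (le_trans IH) // (hx _).1.
have decr n m : x (n + m)%N + s / 2 ^+ (n + m) <= x n + s / 2 ^+ n.
  by elim: m => [|m IH]; rewrite ?addn0 // addnS (le_trans (hx _).2).
have pos n : 0 <= s / 2 ^+ n by rewrite divr_ge0 // exprn_ge0.
have ub n m : x m <= x n + s / 2 ^+ n.
  apply: le_trans (decr n m); rewrite addnC; apply: le_trans (incr m n) _.
  by have := pos (m + n)%N; lra.
exists (sup (range x)) => n; apply/andP; split.
  apply: sup_ubound; last by exists n.
  by exists (x n + s / 2 ^+ n) => _ [m _ <-].
by apply: ge_sup => [|_ [m _ <-]] //; exists (x 0%N); exists 0%N.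
Qed.

(** Cousin's lemma for squares: if [P] failed, it would fail on one quarter, then on a quarter of
    that, and so on; these squares shrink to a point [w], and the local hypothesis at [w]
    contradicts the failure on a small one. *)
Lemma csq_cousin (P : C -> R -> Prop) a s : 0 < s ->
  (forall a s, P a (s / 2) -> P (a + (s / 2)%:C%C) (s / 2) ->
    P (a + 'i%C * (s / 2)%:C%C) (s / 2) ->
    P (a + (s / 2)%:C%C + 'i%C * (s / 2)%:C%C) (s / 2) -> P a s) ->
  (forall w, csq a s w -> exists2 d : R, 0 < d & forall a' s', 0 < s' -> s' < d ->
    csq a' s' w -> csq a' s' `<=` csq a s -> P a' s') -> P a s.
Proof.
move=> s0 hP hloc; apply: contrapT => nP.
(* The offset [q], with coordinates 0 or 1, selects a quarter on which [P] fails if it fails on the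
   square; nesting follows from [0 <= q <= 1]. *)
have nxt (p : C * R) : exists q : R * R, [/\ 0 <= q.1 <= 1, 0 <= q.2 <= 1 &
    ~ P p.1 p.2 -> ~ P (p.1 + (q.1 * (p.2 / 2))%:C%C + 'i%C * (q.2 * (p.2 / 2))%:C%C) (p.2 / 2)].
  case: p => a' s' /=.
  have i0 : 'i%C * 0%:C%C = 0 :> C by rewrite mulr0.
  have [p1|p1] := pselect (P a' (s' / 2)); last first.
    by exists (0, 0); rewrite /= !mul0r i0 !addr0 !lexx !ler01.
  have [p2|p2] := pselect (P (a' + (s' / 2)%:C%C) (s' / 2)); last first.
    by exists (1, 0); rewrite /= mul1r mul0r i0 !addr0 !lexx !ler01.
  have [p3|p3] := pselect (P (a' + 'i%C * (s' / 2)%:C%C) (s' / 2)); last first.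
    by exists (0, 1); rewrite /= mul1r mul0r !addr0 !lexx !ler01.
  exists (1, 1); rewrite /= !mul1r !lexx !ler01; split=> // nP' p4; apply: nP'.
  exact: hP.
have {nxt}[q hq] := choice nxt.
pose F (p : C * R) := (p.1 + ((q p).1 * (p.2 / 2))%:C%C + 'i%C * ((q p).2 * (p.2 / 2))%:C%C, p.2 / 2).
pose p n := iter n F (a, s).
have p2 n : (p n).2 = s / 2 ^+ n.
  elim: n => [|n IH]; first by rewrite expr0 divr1.
  by rewrite /p iterS -/(p n) /= IH exprS invfM mulrA mulrAC.
have pos n : 0 < s / 2 ^+ n by rewrite divr_gt0 // exprn_gt0.
have nPn n : ~ P (p n).1 (p n).2.
  by elim: n => [//|n IH]; have [_ _ h] := hq (p n); exact: h.
have half n : s / 2 ^+ n.+1 = s / 2 ^+ n / 2 by rewrite exprS invfM mulrA mulrAC.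
have stepR n : cRe (p n).1 <= cRe (p n.+1).1 /\
    cRe (p n.+1).1 + s / 2 ^+ n.+1 <= cRe (p n).1 + s / 2 ^+ n.
  have [/andP[q0 q1] _ _] := hq (p n).
  rewrite half /p iterS -/(p n) /= p2.
  have := pos n; move: (s / 2 ^+ n) => r r0; case: (p n).1 => x y /=.
  set k := (q _).1 in q0 q1 *.
  have : 0 <= k * (r / 2) by rewrite mulr_ge0 // divr_ge0 // ltW.
  have : k * (r / 2) <= r / 2 by rewrite ler_piMl // divr_ge0 // ltW.
  by lra.
have stepI n : cIm (p n).1 <= cIm (p n.+1).1 /\
    cIm (p n.+1).1 + s / 2 ^+ n.+1 <= cIm (p n).1 + s / 2 ^+ n.
  have [_ /andP[q0 q1] _] := hq (p n).
  rewrite half /p iterS -/(p n) /= p2.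
  have := pos n; move: (s / 2 ^+ n) => r r0; case: (p n).1 => x y /=.
  set k := (q _).2 in q0 q1 *.
  have : 0 <= k * (r / 2) by rewrite mulr_ge0 // divr_ge0 // ltW.
  have : k * (r / 2) <= r / 2 by rewrite ler_piMl // divr_ge0 // ltW.
  by lra.
have [x hx] := nested_halving (ltW s0) stepR.
have [y hy] := nested_halving (ltW s0) stepI.
have win n : csq (p n).1 (p n).2 (Complex x y) by rewrite p2; split.
have sub n : csq (p n).1 (p n).2 `<=` csq a s.
  elim: n => [//|n IH]; apply: subset_trans IH => w; rewrite !p2.
  have := stepR n; have := stepI n; rewrite /csq /=.
  by move=> [? ?] [? ?] [/andP[? ?] /andP[? ?]]; split; apply/andP; split; lra.
have [d d0 hd] := hloc _ (win 0%N).
have [n hn] := half_small (divr_gt0 d0 (mulr_gt0 (ltr0Sn R 1) s0)).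
apply: (nPn n); apply: hd => //; rewrite p2 // -exprVn.
have : s * 2^-1 ^+ n <= s * (d / (2 * s)) by rewrite ler_wpM2l // ltW.
have -> : s * (d / (2 * s)) = d / 2 by field; rewrite gt_eqF.
by lra.
Qed.

(** The odd square root, as [Num.sqrt] is 0 on negative reals. It is increasing, and its increment
    over an interval around 0 is at least the square root of the length. *)
Definition ssqrt u : R := Num.sqrt u - Num.sqrt (- u).

Lemma ssqrt_mono u v : u <= v -> ssqrt u <= ssqrt v.
Proof.
by move=> uv; rewrite /ssqrt lerB // ler_wsqrtr // lerN2.
Qed.

Lemma ssqrt_jump u v : u <= 0 -> 0 <= v -> Num.sqrt (v - u) <= ssqrt v - ssqrt u.
Proof.
move=> u0 v0; rewrite /ssqrt (@ler0_sqrtr _ (- v)) ?oppr_le0 // (@ler0_sqrtr _ u) //.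
rewrite subr0 sub0r opprK.
have a0 := sqrtr_ge0 v; have b0 := sqrtr_ge0 (- u).
rewrite -[leRHS]ger0_norm ?addr_ge0 // -sqrtr_sqr ler_wsqrtr // sqrrD.
rewrite !sqr_sqrtr ?oppr_ge0 //.
have : 0 <= Num.sqrt v * Num.sqrt (- u) by rewrite mulr_ge0.
by rewrite mulr2n; lra.
Qed.

(* Bisection compares the contour integral with this additive weight.  The area
   term handles points of differentiability, where the integral is [o(s ^ 2)];
   the second term is at least [s] for squares containing [z], where continuity
   only gives [o(s)]. *)
Definition sqweight z a s : R := s ^+ 2 +
  (ssqrt (cRe a - cRe z + s) - ssqrt (cRe a - cRe z)) *
  (ssqrt (cIm a - cIm z + s) - ssqrt (cIm a - cIm z)).

(** Both terms are products of increments of one-variable functions, hence additive in each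
    coordinate. *)
Lemma sqweight_split z a s : sqweight z a s =
  sqweight z a (s / 2) + sqweight z (a + (s / 2)%:C%C) (s / 2) +
  sqweight z (a + 'i%C * (s / 2)%:C%C) (s / 2) +
  sqweight z (a + (s / 2)%:C%C + 'i%C * (s / 2)%:C%C) (s / 2).
Proof.
case: a z => x y [x0 y0]; rewrite /sqweight /=.
have r1 : x + s / 2 - x0 = x - x0 + s / 2 by ring.
have r2 : y + s / 2 - y0 = y - y0 + s / 2 by ring.
rewrite !(mul0r, mulr0, mul1r, addr0, add0r, subr0) !(r1, r2).
have r3 c : c + s / 2 + s / 2 = c + s by field.
by rewrite !r3; field.
Qed.

Lemma sqweight_ge z a s : 0 <= s -> s ^+ 2 <= sqweight z a s.
Proof. by move=> s0; rewrite lerDl mulr_ge0 // subr_ge0 ssqrt_mono // lerDl. Qed.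

(** Both coordinate intervals contain that of [z], so each [ssqrt] increment is at least
    [Num.sqrt s], and their product at least [s]. *)
Lemma sqweight_ge_side z a s : 0 <= s -> csq a s z -> s <= sqweight z a s.
Proof.
move=> s0 [/andP[x1 x2] /andP[y1 y2]].
have e : Num.sqrt s * Num.sqrt s = s by rewrite -expr2 sqr_sqrtr.
have j1 := @ssqrt_jump (cRe a - cRe z) (cRe a - cRe z + s) ltac:(lra) ltac:(lra).
have j2 := @ssqrt_jump (cIm a - cIm z) (cIm a - cIm z + s) ltac:(lra) ltac:(lra).
move: j1 j2; rewrite !(addrAC _ s) !subrr !add0r => j1 j2.
rewrite /sqweight; apply: le_trans (_ : 0 + Num.sqrt s * Num.sqrt s <= _).
  by rewrite add0r e.
by apply: lerD; rewrite ?sqr_ge0 // ler_pM // sqrtr_ge0.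
Qed.

Lemma csq_diam a s w z : csq a s w -> csq a s z -> nc (w - z) <= 2 * s.
Proof.
move=> [/andP[? ?] /andP[? ?]] [/andP[? ?] /andP[? ?]].
apply: le_trans (nc_le_ReIm _) _; rewrite ReD ImD ReN ImN.
have : `|cRe w - cRe z| <= s by rewrite ler_norml; lra.
have : `|cIm w - cIm z| <= s by rewrite ler_norml; lra.
by lra.
Qed.

Lemma csq_sub a a1 s : cRe a <= cRe a1 <= cRe a + s / 2 ->
  cIm a <= cIm a1 <= cIm a + s / 2 -> csq a1 (s / 2) `<=` csq a s.
Proof.
move=> /andP[? ?] /andP[? ?] w [/andP[? ?] /andP[? ?]].
by split; apply/andP; split; lra.
Qed.

Lemma csq_quarters a s : 0 <= s -> [/\ csq a (s / 2) `<=` csq a s,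
  csq (a + (s / 2)%:C%C) (s / 2) `<=` csq a s,
  csq (a + 'i%C * (s / 2)%:C%C) (s / 2) `<=` csq a s &
  csq (a + (s / 2)%:C%C + 'i%C * (s / 2)%:C%C) (s / 2) `<=` csq a s].
Proof.
by move=> s0; split; apply: csq_sub; case: a => x y; rewrite /= ?simpm /=; apply/andP; split; lra.
Qed.

Lemma nc_sum4 (x1 x2 x3 x4 : C) (e q1 q2 q3 q4 : R) :
  nc x1 <= e * q1 -> nc x2 <= e * q2 -> nc x3 <= e * q3 -> nc x4 <= e * q4 ->
  nc (x1 + x2 + x3 + x4) <= e * (q1 + q2 + q3 + q4).
Proof.
move=> h1 h2 h3 h4; rewrite !mulrDr.
by do 3 (apply: le_trans (ncD _ _) _; apply: lerD => //).
Qed.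

(** The bound [e * sqweight z a s] passes from the quarters to the square, because both sides split,
    and it holds on small squares around every point. So it holds on the whole square, for every
    [e > 0]. *)
Lemma goursat h a s z : 0 < s -> contsq h a s ->
  (forall w, csq a s w -> w <> z -> derivable h w 1) -> oint h a s%:C%C = 0.
Proof.
move=> s0 ch dh.
suff main (e : R) : 0 < e -> nc (oint h a s%:C%C) <= e * sqweight z a s.
  apply/eqP; rewrite -nc_eq0 eq_le nc_ge0 andbT; apply: le_eps => e e0.
  have W0 : 0 < sqweight z a s by apply: lt_le_trans (sqweight_ge _ _ (ltW s0)); rewrite exprn_gt0.
  by have := main _ (divr_gt0 e0 W0); rewrite divfK ?gt_eqF // add0r.
move=> e0.
apply: (csq_cousin (P := fun a' s' => csq a' s' `<=` csq a s -> 0 < s' ->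
  nc (oint h a' s'%:C%C) <= e * sqweight z a' s')) => //.
  move=> a' s' p1 p2 p3 p4 sub s'0.
  have ch' : contsq h a' s' by move=> w /sub; exact: ch.
  have h0 : 0 < s' / 2 by rewrite divr_gt0.
  rewrite (oint_split (ltW s'0) ch') sqweight_split.
  have [sub1 sub2 sub3 sub4] := csq_quarters a' (ltW s'0).
  apply: nc_sum4; [exact: p1 (subset_trans sub1 sub) h0|
    exact: p2 (subset_trans sub2 sub) h0|exact: p3 (subset_trans sub3 sub) h0|
    exact: p4 (subset_trans sub4 sub) h0].
move=> w wQ; have [wz|wz] := pselect (w = z).
  (* At the exceptional point only continuity is available. Subtracting the constant [h w] leaves
     the integral unchanged, and the bound [e / 4] on a perimeter [4 * s'] gives [e * s'], dominated
     by the weight because the square contains [z]. *)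
  have [d d0 hd] := (contCP h w).1 (ch w wQ) (e / 4) ltac:(by rewrite divr_gt0).
  exists (d / 2); first by rewrite divr_gt0.
  move=> a' s' s'0 s'd w' _ sub _.
  have ch' : contsq h a' s' by move=> w1 /sub; exact: ch.
  have -> : oint h a' s'%:C%C = oint (fun w1 => h w1 - h w) a' s'%:C%C.
    rewrite (ointD (ltW s'0) (contsqb ch') (contsqb (contsq_cst (c := - h w) (a := a') (s := s')))).
    rewrite [X in _ + X](_ : _ = 0) ?addr0 //.
    rewrite -(oint_affine (- h w) 0 0 a' s'%:C%C); apply: eq_oint; first exact: ltW.
    by move=> ? _; rewrite mul0r addr0.
  have ch'' : contsq (fun w1 => h w1 - h w) a' s'.
    exact (contsqD ch' (contsq_cst (c := - h w) (a := a') (s := s'))).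
  apply: le_trans (oint_le (M := e / 4) (ltW s'0) (contsqb ch'') _) _.
    move=> w1 [w1Q _]; apply/ltW/hd; apply: le_lt_trans (csq_diam w1Q w') _; lra.
  apply: le_trans (_ : e * s' <= _); first lra.
  by rewrite ler_wpM2l ?sqweight_ge_side //; [exact: ltW|exact: ltW|rewrite -wz].
have [D hD] : exists D, is_derive w 1 h D by exists ('D_1 h w); apply/derivableP/dh.
(* Subtracting the affine part leaves at most [e / 16 * (2 * s')] on a perimeter [4 * s'], that is
   [e * s' ^+ 2 / 2]. *)
have [r r0 hr] := (is_deriveCP h w D).1 hD (e / 16) ltac:(by rewrite divr_gt0).
exists (r / 2); first by rewrite divr_gt0.
move=> a' s' s'0 s'd w' _ sub _.
have ch' : contsq h a' s' by move=> w1 /sub; exact: ch.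
pose A w1 := h w + D * (w1 - w).
have cA : contsq (fun w1 => - A w1) a' s'.
  rewrite (_ : (fun w1 => - A w1) = fun w1 => (- h w + D * w) + (- D) * w1).
    exact (contsqD (contsq_cst (c := - h w + D * w) (a := a') (s := s')) (contsqZ (c := - D) (a := a') (s := s'))).
  by apply/funext => w1; rewrite /A; ring.
have -> : oint h a' s'%:C%C = oint (fun w1 => h w1 - A w1) a' s'%:C%C.
  rewrite (ointD (ltW s'0) (contsqb ch') (contsqb cA)).
  rewrite [X in _ + X](_ : _ = 0) ?addr0 //.
  rewrite -(oint_affine (- h w) (- D) w a' s'%:C%C); apply: eq_oint; first exact: ltW.
  by move=> w1 _; rewrite /A opprD mulNr.
have ch'' : contsq (fun w1 => h w1 - A w1) a' s'.
  exact (contsqD ch' cA).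
apply: le_trans (oint_le (M := e / 16 * (2 * s')) (ltW s'0) (contsqb ch'') _) _.
  move=> w1 [w1Q _]; have ww := csq_diam w1Q w'.
  rewrite /A opprD addrA; apply: le_trans (hr _ _) _; first by apply: le_lt_trans ww _; lra.
  by rewrite ler_wpM2l //; lra.
apply: le_trans (_ : e * s' ^+ 2 <= _).
  have : 0 <= e * s' ^+ 2 by rewrite mulr_ge0 ?sqr_ge0 // ltW.
  by rewrite expr2; lra.
by rewrite ler_wpM2l ?sqweight_ge // ltW.
Qed.

End Goursat.

(** * Cauchy's formula for a square *)

Section CauchySquare.
Context {R : realType}.
Local Notation C := R[i].
Implicit Types (h f g : C -> C) (a b z w : C) (s t u v m : R).

Lemma derivable_contC f z : derivable f z 1 -> {for z, continuous f}.
Proof.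
move=> /derivableP/is_deriveCP; set D := 'D_1 f z => hD.
apply/contCP => e e0; have [r r0 hr] := hD 1 ltr01.
have k0 : 0 < nc D + 1 by have := nc_ge0 D; lra.
exists (Num.min r (e / (nc D + 1))); first by rewrite lt_min r0 divr_gt0.
move=> y; rewrite lt_min => /andP[/hr h1]; rewrite ltr_pdivlMr // => h2.
have := ncD (f y - f z - D * (y - z)) (D * (y - z)).
rewrite subrK ncM; lra.
Qed.

Lemma is_derive_inv (z w : C) : w != z ->
  is_derive w 1 (fun w => (w - z)^-1) (- (w - z)^-2).
Proof.
move=> wz; have wz0 : w - z != 0 by rewrite subr_eq0.
have hd : is_derive w 1 (fun w : C => w - z) 1.
  rewrite -[X in is_derive _ _ _ X]subr0.
  by apply: is_deriveB.
have df : derivable (fun w : C => w - z) w 1 by exact: ex_derive.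
apply: DeriveDef; first exact: (derivableV (f := fun w : C => w - z)).
rewrite (deriveV (f := fun w : C => w - z)) // derive_val.
by rewrite /GRing.scale /= mulr1.
Qed.

Lemma derivable_inv (z w : C) : w != z -> derivable (fun w : C => (w - z)^-1) w 1.
Proof. by move=> /is_derive_inv h; exact: ex_derive. Qed.

Lemma inv_sub (p q : C) : p != 0 -> q != 0 -> p^-1 - q^-1 = (q - p) * p^-1 * q^-1.
Proof. by move=> p0 q0; field; rewrite p0 q0. Qed.

Lemma nc_inv_le (p : C) m : 0 < m -> m <= nc p -> nc p^-1 <= m^-1.
Proof. by move=> m0 mp; rewrite ncV lef_pV2 // posrE (lt_le_trans m0). Qed.

Lemma nc_neq0 (p : C) m : 0 < m -> m <= nc p -> p != 0.
Proof. by move=> m0 mp; rewrite -nc_gt0 (lt_le_trans m0). Qed.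

(* After [n] halvings, [D a b] is a sum of [2 ^ n] terms of size [O(4 ^ - n)]. *)
Lemma additive_quad_eq0 (D : C -> C -> C) (adm : C -> Prop) (M : R) a b :
  (forall a b, (forall t, 0 <= t <= 1 -> adm (a + t%:C%C * b)) ->
    D a b = D a (b / 2) + D (a + b / 2) (b / 2)) ->
  (forall a b, (forall t, 0 <= t <= 1 -> adm (a + t%:C%C * b)) ->
    nc (D a b) <= M * nc b ^+ 2) ->
  (forall t, 0 <= t <= 1 -> adm (a + t%:C%C * b)) -> D a b = 0.
Proof.
move=> Dadd Dquad ab.
have main n : forall a b, (forall t, 0 <= t <= 1 -> adm (a + t%:C%C * b)) ->
    nc (D a b) <= M * nc b ^+ 2 * 2^-1 ^+ n.
  elim: n => [|n IH] a' b' h; first by rewrite expr0 mulr1; exact: Dquad.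
  have e0 : 2 != 0 :> C by rewrite pnatr_eq0.
  rewrite Dadd //; apply: le_trans (ncD _ _) _.
  have h1 : nc (D a' (b' / 2)) <= M * nc (b' / 2) ^+ 2 * 2^-1 ^+ n.
    apply: IH => t t01; have := h (t / 2) (half_in01 t01).1.
    by congr adm; rewrite real_half; field.
  have h2 : nc (D (a' + b' / 2) (b' / 2)) <= M * nc (b' / 2) ^+ 2 * 2^-1 ^+ n.
    apply: IH => t t01; have := h ((1 + t) / 2) (half_in01 t01).2.
    by congr adm; rewrite real_half real_D; field.
  move: h1 h2; rewrite nc_half expr_div_n [2^-1 ^+ n.+1]exprS; set x := 2^-1 ^+ n.
  have -> : M * (nc b' ^+ 2 / 2 ^+ 2) * x = M * nc b' ^+ 2 * (2^-1 * x) / 2 by field.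
  by lra.
apply/eqP; rewrite -nc_eq0 eq_le nc_ge0 andbT; apply: le_eps => e e0.
set k := M * nc b ^+ 2 in main *.
have k0 : 0 <= k by apply: le_trans (nc_ge0 _) (Dquad a b ab).
have [n hn] := half_small (divr_gt0 e0 (ltr_pwDr ltr01 k0)).
apply: le_trans (main n a b ab) _; rewrite add0r -/k.
have k1 : 0 < k + 1 by lra.
apply: le_trans (ler_wpM2l k0 hn) _; rewrite mulrA ler_pdivrMr // mulrC.
by rewrite ler_wpM2l // ?ltW //; lra.
Qed.

(** The defect in the fundamental theorem of calculus is additive under halving. With [u] and [v]
    the values of [(w - z)^-1] at the two ends, [u - v = b * u * v], so the defect is [b] times the
    mean of [(w - z)^-2 - u * v], which is itself of order [nc b]. *)
Lemma seg_ftc_inv2 a b z m : 0 < m ->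
  (forall t, 0 <= t <= 1 -> m <= nc (a + t%:C%C * b - z)) ->
  seg (fun w => (w - z)^-1 ^+ 2) a b = (a - z)^-1 - (a + b - z)^-1.
Proof.
move=> m0 hab; apply/eqP; rewrite -subr_eq0; apply/eqP.
pose D a b := seg (fun w => (w - z)^-1 ^+ 2) a b - ((a - z)^-1 - (a + b - z)^-1).
have cs a' b' : (forall t, 0 <= t <= 1 -> m <= nc (a' + t%:C%C * b' - z)) ->
   contseg (fun w => (w - z)^-1 ^+ 2) a' b'.
  move=> h; apply: (cont01X (phi := fun t => (a' + t%:C%C * b' - z)^-1)).
  apply: (contseg_cont (h := fun w => (w - z)^-1)) => t /h h1; apply/derivable_contC/derivable_inv.
  by rewrite -subr_eq0 (nc_neq0 m0).
apply: (additive_quad_eq0 (D := D) (adm := fun w => m <= nc (w - z)) (M := 2 * m^-1 ^+ 3)) => //.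
  move=> a' b' h; rewrite /D (seg_half (cs _ _ h)).
  have -> : a' + b' / 2 + b' / 2 = a' + b' by field.
  by ring.
move=> a' b' h; rewrite /D.
have pt0 : a' - z != 0.
  by apply: (nc_neq0 m0); have := h 0 (ltac:(by rewrite lexx ler01)); rewrite mul0r addr0.
have pt1 : a' + b' - z != 0.
  by apply: (nc_neq0 m0); have := h 1 (ltac:(by rewrite lexx ler01)); rewrite mul1r.
have l0 : nc (a' - z)^-1 <= m^-1.
  by apply: (nc_inv_le m0); have := h 0 (ltac:(by rewrite lexx ler01)); rewrite mul0r addr0.
have l1 : nc (a' + b' - z)^-1 <= m^-1.
  by apply: (nc_inv_le m0); have := h 1 (ltac:(by rewrite lexx ler01)); rewrite mul1r.
set u := (a' - z)^-1 in l0 *; set v := (a' + b' - z)^-1 in l1 *.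
have uv : u - v = b' * u * v.
  by rewrite /u /v inv_sub //; congr (_ * _ * _); ring.
rewrite uv /seg -mulrA -mulrBr ncM expr2 mulrCA -mulrA.
rewrite ler_wpM2l ?nc_ge0 //.
have -> : int01 (fun t => (a' + t%:C%C * b' - z)^-1 ^+ 2) - u * v =
    int01 (fun t => (a' + t%:C%C * b' - z)^-1 ^+ 2 - u * v).
  by rewrite int01B ?int01_cst //; [exact: cs|exact: cont01_cst].
apply: int01_le; first by apply: cont01B; [exact: cs|exact: cont01_cst].
move=> t t01; have hx := h t t01; have x0 := nc_neq0 m0 hx.
have lx := nc_inv_le m0 hx; set x := (_ - z)^-1 in lx *.
have xu : x - u = - t%:C%C * b' * x * u.
  by rewrite /x /u inv_sub //; congr (_ * _ * _); ring.
have xv : x - v = (1 - t)%:C%C * b' * x * v.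
  by rewrite /x /v inv_sub // rmorphB; congr (_ * _ * _) => /=; ring.
have -> : x ^+ 2 - u * v = x * (x - u) + u * (x - v) by ring.
rewrite xu xv; apply: le_trans (ncD _ _) _.
have B0 : 0 <= nc b' by exact: nc_ge0.
have m1 : 0 <= m^-1 by rewrite invr_ge0 ltW.
have bnd (c : R) (x1 x2 x3 : C) : 0 <= c <= 1 -> nc x1 <= m^-1 -> nc x2 <= m^-1 -> nc x3 <= m^-1 ->
    c * (nc b' * (nc x1 * (nc x2 * nc x3))) <= nc b' * m^-1 ^+ 3.
  move=> /andP[c0 c1] k1 k2 k3; rewrite -[leRHS]mul1r ler_pM ?mulr_ge0 ?nc_ge0 //.
  rewrite ler_wpM2l // !exprS expr0 mulr1 ler_pM ?mulr_ge0 ?nc_ge0 //.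
  by rewrite ler_pM ?nc_ge0.
have t01' : 0 <= 1 - t <= 1 by case/andP: t01 => *; apply/andP; split; lra.
have b1 := bnd t x x u t01 lx lx l0; have b2 := bnd (1 - t) u x v t01' l0 lx l1.
rewrite !ncM ncN !nc_real; rewrite !ger0_norm; [|by case/andP: t01'|by case/andP: t01].
have -> : nc x * (t * nc b' * nc x * nc u) = t * (nc b' * (nc x * (nc x * nc u))) by ring.
have -> : nc u * ((1 - t) * nc b' * nc x * nc v) = (1 - t) * (nc b' * (nc u * (nc x * nc v))) by ring.
have -> : 2 * (m^-1 ^+ 3 * nc b') = nc b' * m^-1 ^+ 3 + nc b' * m^-1 ^+ 3 by ring.
exact: lerD.
Qed.

(** * The winding integral of a square *)

Definition margin a s m z :=
  (cRe a + m <= cRe z <= cRe a + s - m) /\ (cIm a + m <= cIm z <= cIm a + s - m).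

Lemma margin_sqb a s m z w : 0 < m -> margin a s m z -> sqb a s w -> m <= nc (w - z).
Proof.
move=> m0 [/andP[x1 x2] /andP[y1 y2]] [_ hw].
have := Re_le_nc (w - z); have := Im_le_nc (w - z).
rewrite ReD ImD ReN ImN => /ler_normlP[i1 i2] /ler_normlP[r1 r2].
by case: hw => e; rewrite e in r1 r2 i1 i2; lra.
Qed.

Lemma seg_pt_sqb a s m z : 0 <= s -> 0 < m -> margin a s m z ->
  [/\ forall t, 0 <= t <= 1 -> m <= nc (a + t%:C%C * s%:C%C - z),
      forall t, 0 <= t <= 1 -> m <= nc (a + s%:C%C + t%:C%C * ('i%C * s%:C%C) - z),
      forall t, 0 <= t <= 1 -> m <= nc (a + 'i%C * s%:C%C + t%:C%C * s%:C%C - z) &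
      forall t, 0 <= t <= 1 -> m <= nc (a + t%:C%C * ('i%C * s%:C%C) - z)].
Proof.
move=> s0 m0 hz; split=> t t01; apply: (margin_sqb m0 hz);
  by have [] := sqb_edges a s0 t01.
Qed.

Lemma oint_inv2 a s m z : 0 <= s -> 0 < m -> margin a s m z ->
  oint (fun w => (w - z)^-1 ^+ 2) a s%:C%C = 0.
Proof.
move=> s0 m0 hz; have [e1 e2 e3 e4] := seg_pt_sqb s0 m0 hz.
rewrite /oint (seg_ftc_inv2 m0 e1) (seg_ftc_inv2 m0 e2) (seg_ftc_inv2 m0 e3) (seg_ftc_inv2 m0 e4).
by rewrite (_ : a + s%:C%C + 'i%C * s%:C%C = a + 'i%C * s%:C%C + s%:C%C); ring.
Qed.

Lemma margin_convex a s m z z' t : margin a s m z -> margin a s m z' -> 0 <= t <= 1 ->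
  margin a s m (z + t%:C%C * (z' - z)).
Proof.
move=> [/andP[x1 x2] /andP[y1 y2]] [/andP[x1' x2'] /andP[y1' y2']] /andP[t0 t1].
have conv (p q c d : R) : c <= p <= d -> c <= q <= d -> c <= p + t * (q - p) <= d.
  move=> /andP[? ?] /andP[? ?]; apply/andP; split; nra.
have er : cRe (z + t%:C%C * (z' - z)) = cRe z + t * (cRe z' - cRe z) :> R.
  by case: (z) (z') => [? ?] [? ?] /=; ring.
have ei : cIm (z + t%:C%C * (z' - z)) = cIm z + t * (cIm z' - cIm z) :> R.
  by case: (z) (z') => [? ?] [? ?] /=; ring.
by rewrite /margin er ei; split; apply: conv; apply/andP; split.
Qed.


Lemma contb_inv a s m z : 0 < m -> margin a s m z -> contb (fun w => (w - z)^-1) a s.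
Proof.
move=> m0 hz w /(margin_sqb m0 hz) mw; apply/derivable_contC/derivable_inv.
by rewrite -subr_eq0 (nc_neq0 m0).
Qed.

Lemma contbM f g a s : contb f a s -> contb g a s -> contb (fun w => f w * g w) a s.
Proof. by move=> cf cg w wQ; exact: (continuousM (cf w wQ) (cg w wQ)). Qed.

Lemma contb_inv2 a s m z : 0 < m -> margin a s m z -> contb (fun w => (w - z)^-1 ^+ 2) a s.
Proof. move=> m0 hz; exact (contbM (contb_inv m0 hz) (contb_inv m0 hz)). Qed.

(** The winding number without its normalising factor. *)
Definition wind a s z := oint (fun w => (w - z)^-1) a s%:C%C.

(** Expanding [(w - z')^-1] at [z] to first order, the linear term integrates to 0 because
    [(w - z)^-2] has a primitive; the remainder is quadratic. *)
Lemma wind_quad a s m z z' : 0 <= s -> 0 < m -> margin a s m z -> margin a s m z' ->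
  nc (wind a s z' - wind a s z) <= 4 * s * m^-1 ^+ 3 * nc (z' - z) ^+ 2.
Proof.
move=> s0 m0 hz hz'.
have c1 := contb_inv m0 hz; have c2 := contb_inv m0 hz'; have c3 := contb_inv2 m0 hz.
have cc c : contb (fun=> c) a s := contsqb (contsq_cst (c := c) (a := a) (s := s)).
have c4 : contb (fun w => (w - z)^-1 ^+ 2 * (w - z')^-1) a s by exact (contbM c3 c2).
have c5 := contbM (cc (z' - z)) c3; have c6 := contbM (cc ((z' - z) ^+ 2)) c4.
have c7 : contb (fun w => (z' - z) * (w - z)^-1 ^+ 2 +
    (z' - z) ^+ 2 * ((w - z)^-1 ^+ 2 * (w - z')^-1)) a s.
  by move=> w wQ; exact (continuousD (c5 w wQ) (c6 w wQ)).
have E : wind a s z' = wind a s z + ((z' - z) * oint (fun w => (w - z)^-1 ^+ 2) a s%:C%C +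
    (z' - z) ^+ 2 * oint (fun w => (w - z)^-1 ^+ 2 * (w - z')^-1) a s%:C%C).
  rewrite -(ointZ (z' - z) s0 c3) -(ointZ ((z' - z) ^+ 2) s0 c4) -(ointD s0 c5 c6).
  rewrite /wind -(ointD s0 c1 c7).
  apply: (eq_oint s0) => w wQ.
  have w1 := nc_neq0 m0 (margin_sqb m0 hz wQ); have w2 := nc_neq0 m0 (margin_sqb m0 hz' wQ).
  by field; rewrite w1 w2.
rewrite E addrAC subrr add0r (oint_inv2 s0 m0 hz) mulr0 add0r ncM ncX mulrC.
rewrite ler_wpM2r ?exprn_ge0 ?nc_ge0 //.
apply: (oint_le s0 c4) => w wQ.
have l1 := nc_inv_le m0 (margin_sqb m0 hz wQ); have l2 := nc_inv_le m0 (margin_sqb m0 hz' wQ).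
rewrite ncM ncX [m^-1 ^+ 3]exprSr ler_pM ?exprn_ge0 ?nc_ge0 //.
by rewrite lerXn2r // nnegrE ?nc_ge0 // invr_ge0 ltW.
Qed.

(** The increment of [wind] along a segment is additive under halving and quadratic by [wind_quad],
    hence zero; the points with a given margin form a convex set. *)
Lemma wind_cst a s m z z' : 0 <= s -> 0 < m -> margin a s m z -> margin a s m z' ->
  wind a s z' = wind a s z.
Proof.
move=> s0 m0 hz hz'; apply/eqP; rewrite -subr_eq0; apply/eqP.
pose D a' b' := wind a s (a' + b') - wind a s a'.
rewrite -[z' in wind a s z'](subrK z) addrC (addrC (z' - z)) addrC -/(D z (z' - z)).
apply: (additive_quad_eq0 (D := D) (adm := margin a s m) (M := 4 * s * m^-1 ^+ 3)).
- move=> a' b' _; rewrite /D (_ : a' + b' / 2 + b' / 2 = a' + b'); last by field.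
  by ring.
- move=> a' b' h; rewrite /D.
  have h0 : margin a s m a'.
    by have := h 0 (ltac:(by rewrite lexx ler01)); rewrite mul0r addr0.
  have h1 : margin a s m (a' + b').
    by have := h 1 (ltac:(by rewrite lexx ler01)); rewrite mul1r.
  by have := wind_quad s0 m0 h0 h1; rewrite (addrC a') addrK.
- by move=> t t01; exact: margin_convex.
Qed.

(* The value is [2 i pi], but only [cpi_neq0] matters. *)
Definition cpi : C := 2 * int01 (fun t => 2 / ((2 * t - 1)%:C%C - 'i%C)) -
  2 * int01 (fun t => 2 / ((2 * t - 1)%:C%C + 'i%C)).

Lemma real_pm_i (x : R) : x%:C%C - 'i%C != 0 /\ x%:C%C + 'i%C != 0.
Proof.
by split; apply/negP => /eqP/(congr1 (@cIm R)) /=; rewrite ?add0r ?sub0r => /eqP;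
  rewrite ?oppr_eq0 oner_eq0.
Qed.

Lemma cont01_pm_i : cont01 (fun t : R => 2 / ((2 * t - 1)%:C%C - 'i%C)) /\
  cont01 (fun t : R => 2 / ((2 * t - 1)%:C%C + 'i%C)).
Proof.
have c (k : C) : cont01 (fun t : R => (2 * t - 1)%:C%C + k).
  apply: cont01D; last exact: cont01_cst.
  rewrite (_ : (fun t => _) = fun t => 2 * t%:C%C + -1); last first.
    by apply/funext => t; rewrite rmorphB rmorphM rmorph1 rmorph_nat.
  apply: cont01D; last exact: cont01_cst.
  by apply: cont01M; [exact: cont01_cst|exact: cont01_id].
split; apply: cont01M; try exact: cont01_cst; apply: cont01V => // t _;
  by have [] := real_pm_i (2 * t - 1).
Qed.

(** With [x = 2 * t - 1], the two integrands differ by [4 i / (x ^ 2 + 1)], of imaginary part at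
    least 2 because [|x| <= 1]. *)
Lemma cpi_neq0 : cpi != 0.
Proof.
have [c1 c2] := cont01_pm_i.
apply/negP => /eqP/(congr1 (@cIm R)); rewrite /cpi -mulrBr -int01B //.
set I := int01 _.
have : 2 <= cIm I.
  apply: int01_Im_ge; first exact: cont01B.
  move=> t /andP[t0 t1]; set x := 2 * t - 1.
  have [p1 p2] := real_pm_i x.
  have -> : 2 / (x%:C%C - 'i%C) - 2 / (x%:C%C + 'i%C) = Complex 0 (4 / (x ^+ 2 + 1)) :> C.
    have x0 : x ^+ 2 + 1 != 0 by apply: lt0r_neq0; have := sqr_ge0 x; lra.
    have E : (x%:C%C - 'i%C) * (x%:C%C + 'i%C) = (x ^+ 2 + 1)%:C%C.
      by simpc; congr (_ +i* _)%C; ring.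
    rewrite -mulrBr inv_sub // -mulrA -invfM E -fmorphV /=.
    set r := (x ^+ 2 + 1)^-1.
    rewrite (_ : (2 : C) = 2%:C%C) ?rmorph_nat //.
    by simpc; congr (_ +i* _)%C; ring.
  rewrite /= ler_pdivlMr; last by have := sqr_ge0 x; lra.
  have : t * t <= t by rewrite ler_piMl.
  by rewrite /x expr2; lra.
by case: I => p q; simpc => /=; lra.
Qed.

(** Seen from the centre, each side is a rotated and dilated copy of [[-1, 1] - i] (bottom, right)
    or [[-1, 1] + i] (top, left), and [dw / (w - z)] is invariant under rotation and dilation. *)
Lemma wind_center a s : 0 < s -> wind a s (a + (s / 2)%:C%C + 'i%C * (s / 2)%:C%C) = cpi.
Proof.
move=> s0; rewrite /wind /cpi /oint.
set z := a + _ + _; set b := s%:C%C; set J := int01 _; set T := int01 _.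
have b0 : b != 0 by apply/negP => /eqP[]/eqP; rewrite gt_eqF.
have [c1 c2] := cont01_pm_i.
have zE : z = a + b / 2 + 'i%C * (b / 2) by rewrite /z real_half.
have i2 : 'i%C * 'i%C = -1 :> C by rewrite -expr2 sqr_i.
have i0 : 'i%C != 0 :> C by apply/negP => /eqP[]/eqP; rewrite oner_eq0.
have xE t : (2 * t - 1)%:C%C = 2 * t%:C%C - 1 :> C by rewrite rmorphB rmorphM rmorph1 rmorph_nat.
have key (a' b' sg : C) : b' != 0 -> a' - z = b' / 2 * (- 1 + sg) ->
   (forall t : R, (2 * t - 1)%:C%C + sg != 0) ->
   cont01 (fun t : R => 2 / ((2 * t - 1)%:C%C + sg)) ->
   seg (fun w => (w - z)^-1) a' b' = int01 (fun t : R => 2 / ((2 * t - 1)%:C%C + sg)).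
  move=> b'0 h nz cs; apply: (mulfI (invr_neq0 b'0)).
  rewrite -(int01Z _ cs) /seg mulKf //; apply: eq_int01 => t _.
  have := nz t; rewrite xE => nzt.
  have -> : a' + t%:C%C * b' - z = b' / 2 * (2 * t%:C%C - 1 + sg).
    by rewrite addrAC h; field.
  by field; rewrite nzt b'0.
have ib0 : 'i%C * b != 0 by rewrite mulf_neq0.
rewrite (key a b (- 'i%C)) //; last 2 first.
- by rewrite zE; field.
- by move=> t; exact: (real_pm_i _).1.
rewrite (key (a + b) ('i%C * b) (- 'i%C)) //; last 2 first.
- rewrite zE (_ : 'i%C * b / 2 * (-1 - 'i%C) = b / 2 * (- 'i%C - 'i%C * 'i%C)); last by ring.
  by rewrite i2; field.
- by move=> t; exact: (real_pm_i _).1.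
rewrite (key (a + 'i%C * b) b 'i%C) //; last 2 first.
- by rewrite zE; field.
- by move=> t; exact: (real_pm_i _).2.
rewrite (key a ('i%C * b) 'i%C) //; last 2 first.
- rewrite zE (_ : 'i%C * b / 2 * (-1 + 'i%C) = b / 2 * (- 'i%C + 'i%C * 'i%C)); last by ring.
  by rewrite i2; field.
- by move=> t; exact: (real_pm_i _).2.
by rewrite -/J -/T; ring.
Qed.

Definition csqo a s : set C :=
  [set w | (cRe a < cRe w < cRe a + s) /\ (cIm a < cIm w < cIm a + s)].

Lemma csqo_margin a s z : csqo a s z -> exists2 m, 0 < m & margin a s m z.
Proof.
move=> [/andP[x1 x2] /andP[y1 y2]].
exists (Num.min (Num.min (cRe z - cRe a) (cRe a + s - cRe z))
                (Num.min (cIm z - cIm a) (cIm a + s - cIm z))).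
  by rewrite !lt_min !subr_gt0 x1 x2 y1 y2.
set m := Num.min _ _.
have : m <= m by []. rewrite {2}/m !le_min => /andP[/andP[h1 h2] /andP[h3 h4]].
by split; apply/andP; split; lra.
Qed.

Lemma wind_in a s z : 0 < s -> csqo a s z -> wind a s z = cpi.
Proof.
move=> s0 /csqo_margin[m m0 hm].
(* Shrunk so that the centre of the square has this margin as well as [z]. *)
pose m' := Num.min m (s / 2).
have m'0 : 0 < m' by rewrite lt_min m0 divr_gt0.
have m'm : m' <= m by rewrite ge_min lexx.
have m's : m' <= s / 2 by rewrite ge_min lexx orbT.
rewrite -(wind_center a s0).
apply/esym/(wind_cst (ltW s0) m'0).
  by case: hm => /andP[? ?] /andP[? ?]; split; apply/andP; split; lra.
by clear hm; case: a => x y; rewrite /margin /= ?simpm /=; split; apply/andP; split; lra.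
Qed.

(* The exceptional point of [goursat] absorbs the removable singularity of the difference quotient. *)
Lemma cauchy_in f a s z : 0 < s -> csqo a s z ->
  (forall w, csq a s w -> derivable f w 1) ->
  oint (fun w => f w * (w - z)^-1) a s%:C%C = f z * cpi.
Proof.
move=> s0 zQ df.
have [m m0 hm] := csqo_margin zQ.
have zq : csq a s z.
  by case: zQ => /andP[? ?] /andP[? ?]; split; apply/andP; split; apply: ltW.
have [D hD] : exists D, is_derive z 1 f D by exists ('D_1 f z); apply/derivableP/df.
pose h w := if w == z then D else (f w - f z) * (w - z)^-1.
have hder w : csq a s w -> w <> z -> derivable h w 1.
  move=> wQ /eqP wz; have wz0 : 0 < nc (w - z) by rewrite nc_gt0 subr_eq0.
  apply: (near_eq_derivable (f := fun w => (f w - f z) * (w - z)^-1)).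
    apply/nbhsCP; exists (nc (w - z)) => // y yw.
    rewrite /h ifN //; apply: contraTneq yw => ->.
    by rewrite ncBC ltxx.
  apply: (derivableM (f := fun w => f w - f z)).
    by apply: (derivableB (df w wQ)); exact: derivable_cst.
  exact: derivable_inv.
have hc : contsq h a s.
  move=> w wQ; have [->|/eqP wz] := eqVneq w z; last first.
    exact (derivable_contC (hder w wQ wz)).
  apply/contCP => e e0.
  have [r r0 hr] := (is_deriveCP f z D).1 hD (e / 2) (divr_gt0 e0 (ltr0Sn _ 1)).
  exists r => // y /hr; rewrite /h eqxx; case: eqVneq => [_ _|yz].
    by rewrite subrr nc0.
  have yz0 : 0 < nc (y - z) by rewrite nc_gt0 subr_eq0.
  have yz1 : y - z != 0 by rewrite subr_eq0.
  rewrite -ler_pdivrMr // -ncV -ncM mulrBl mulfK // => H.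
  by apply: le_lt_trans H _; lra.
have H0 := goursat s0 hc hder.
have cf : contsq f a s by move=> w wQ; exact (derivable_contC (df w wQ)).
have ci := contb_inv m0 hm.
have cfi := contbM (contsqb cf) ci.
have cz : contb (fun w => - f z * (w - z)^-1) a s.
  exact (contbM (contsqb (contsq_cst (c := - f z) (a := a) (s := s))) ci).
apply/eqP; rewrite -subr_eq0 -(wind_in s0 zQ) -mulNr /wind -(ointZ _ (ltW s0) ci).
rewrite -(ointD (ltW s0) cfi cz) -H0; apply/eqP.
apply: (eq_oint (ltW s0)) => w wQ; rewrite /h ifN; last first.
  by rewrite -subr_eq0; exact: (nc_neq0 m0 (margin_sqb m0 hm wQ)).
by rewrite -mulrDl.
Qed.

Lemma cauchy_out f a s z : 0 < s -> ~ csq a s z ->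
  (forall w, csq a s w -> derivable f w 1) ->
  oint (fun w => f w * (w - z)^-1) a s%:C%C = 0.
Proof.
move=> s0 zQ df.
have hder w : csq a s w -> derivable (fun w => f w * (w - z)^-1) w 1.
  move=> wQ; apply: (derivableM (df w wQ)); apply: derivable_inv.
  by apply: contra_not_neq zQ => <-.
apply: (goursat (z := z) s0) => [w wQ|w wQ _]; last exact: hder.
exact (derivable_contC (hder w wQ)).
Qed.

End CauchySquare.

(** * Cauchy's formula near a compact set *)

Section CauchyKernel.
Context {R : realType}.
Local Notation C := R[i].
Implicit Types (f g : C -> C) (a b z w : C) (s t m : R).

Lemma compact_lebesgueC (K : set C) (P : R -> C -> Prop) : compact K ->
  (forall k, K k -> exists2 d : R, 0 < d & forall y e, nc (y - k) < d -> 0 < e -> e < d -> P e y) ->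
  exists2 d : R, 0 < d & forall k, K k -> P d k.
Proof.
move=> cK h; apply: (compact_lebesgue cK) => k /h[d d0 hd].
by exists d => //; apply/nbhsCP; exists d => // y yk e; exact: hd.
Qed.

Lemma inv_shrink (M : R) : 0 <= M -> exists2 d : R, 0 < d & forall e, 0 < e -> e < d -> M <= e^-1.
Proof.
move=> M0; have M1 : 0 < M + 1 by lra.
exists (M + 1)^-1; first by rewrite invr_gt0.
move=> e e0; rewrite -[e in e < _]invrK ltf_pV2 ?posrE ?invr_gt0 //.
by lra.
Qed.

Lemma cont01_bounded (phi : R -> C) : cont01 phi ->
  exists2 M : R, 0 < M & forall t, 0 <= t <= 1 -> nc (phi t) <= M.
Proof.
move=> h; have [t t01|d d0 hd] := @compact_lebesgue01 R (fun d t => nc (phi t) <= d^-1).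
  have [d d0 hd] := h t t01 1 ltr01.
  have [d' d'0 hd'] := inv_shrink (addr_ge0 (nc_ge0 (phi t)) ler01).
  exists (Num.min d d'); first by rewrite lt_min d0.
  move=> s e; rewrite !lt_min => /andP[/hd h1 _] e0 /andP[_ /(hd' _ e0) h2].
  by apply: le_trans h2; have := ncBd (phi s) (phi t); lra.
by exists d^-1 => //; rewrite invr_gt0.
Qed.

Lemma compact_boundedC (K : set C) : compact K ->
  exists2 M : R, 0 < M & forall k, K k -> nc k <= M.
Proof.
move=> cK; have [k kK|d d0 hd] := @compact_lebesgueC K (fun d (x : C) => nc x <= d^-1) cK.
  have [d d0 hd] := inv_shrink (addr_ge0 (nc_ge0 k) ler01).
  exists (Num.min 1 d); first by rewrite lt_min ltr01.
  move=> y e; rewrite !lt_min => /andP[h1 _] e0 /andP[_ /(hd _ e0) h2].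
  by apply: le_trans h2; have := ncBd y k; lra.
by exists d^-1 => //; rewrite invr_gt0.
Qed.

Lemma compact_dist_open (K V : set C) : compact K -> open V -> K `<=` V ->
  exists2 d : R, 0 < d & forall k w, K k -> nc (w - k) < d -> V w.
Proof.
move=> cK oV KV.
have [k kK|d d0 hd] := @compact_lebesgueC K (fun d k => forall w, nc (w - k) < d -> V w) cK.
  have /nbhsCP[e e0 he] := open_nbhs_nbhs (conj oV (KV k kK)).
  exists (e / 2); first by rewrite divr_gt0.
  move=> y e' yk _ e'e w wy; apply: he.
  by have := ncD (w - y) (y - k); rewrite subrKA; lra.
by exists d => // k w /hd; exact.
Qed.

(** For [u = (g - z)^-1], [v = (g - y)^-1] and [h = y - z], this is the first-order expansion of
    [(g - z)^-k] in [z], with a constant that depends only on [k] and on the bound [B], hence not on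
    the point [g] of the path. *)
Lemma inv_pow_taylor (B : R) k : 0 <= B -> exists2 M : R, 0 <= M & forall u v h : C,
  nc u <= B -> nc v <= B -> v - u = h * u * v ->
  nc (v ^+ k - u ^+ k - k%:R * h * u ^+ k.+1) <= M * nc h ^+ 2.
Proof.
move=> B0; elim: k => [|k [M M0 IH]].
  by exists 0 => // u v h _ _ _; rewrite !expr0 subrr !mul0r subrr nc0.
exists (B * M + k.+1%:R * B ^+ k.+3).
  by rewrite addr_ge0 // mulr_ge0 // ?exprn_ge0 // ler0n.
move=> u v h uB vB vu.
have -> : v ^+ k.+1 - u ^+ k.+1 - k.+1%:R * h * u ^+ k.+2 =
    v * (v ^+ k - u ^+ k - k%:R * h * u ^+ k.+1) + k.+1%:R * (u ^+ k.+2 * v) * h ^+ 2.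
  apply/eqP; rewrite -subr_eq0 -natr1 !exprS; set x := u ^+ k; set y := v ^+ k.
  rewrite [X in X == _](_ : _ = x * (1 + (k%:R + 1) * h * u) * (v - u - h * u * v)).
    by rewrite vu subrr mulr0.
  by rewrite expr0; ring.
apply: le_trans (ncD _ _) _; rewrite mulrDl; apply: lerD.
  by rewrite ncM -[B * M * _]mulrA ler_pM ?nc_ge0 //; exact: IH.
rewrite (ncM _ (h ^+ 2)) (ncX h) (ncM k.+1%:R) nc_nat (ncM (u ^+ k.+2)) (ncX u).
rewrite ler_wpM2r ?exprn_ge0 ?nc_ge0 // ler_wpM2l ?ler0n //.
rewrite [B ^+ _]exprSr ler_pM ?exprn_ge0 ?nc_ge0 //.
by rewrite lerXn2r // nnegrE nc_ge0.
Qed.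

(** The [k]-th Taylor coefficient at [z] of a Cauchy integral along [gam]. The speed of [gam] is not
    included: on segments it is constant and is put into a coefficient outside. *)
Definition edgeK (phi gam : R -> C) k z := int01 (fun t => phi t * (gam t - z)^-1 ^+ k.+1).

Lemma cont01_edgeK phi gam k z m : 0 < m -> cont01 phi -> cont01 gam ->
  (forall t, 0 <= t <= 1 -> m <= nc (gam t - z)) ->
  cont01 (fun t => phi t * (gam t - z)^-1 ^+ k).
Proof.
move=> m0 cp cg hm; apply: cont01M => //; apply: cont01X; apply: cont01V.
  by apply: cont01B => //; exact: cont01_cst.
by move=> t t01; exact: (nc_neq0 m0 (hm t t01)).
Qed.

(** Differentiation under the integral: for [y] within [m / 2] of [z] the path keeps the distance
    [m / 2] from [y], so the expansion of the integrand has an error uniform in [t]. *)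
Lemma edgeK_derive phi gam k z m : 0 < m -> cont01 phi -> cont01 gam ->
  (forall t, 0 <= t <= 1 -> m <= nc (gam t - z)) ->
  is_derive z 1 (edgeK phi gam k) (k.+1%:R * edgeK phi gam k.+1 z).
Proof.
move=> m0 cp cg hm; apply/is_deriveCP => e e0.
have [M M0 hM] := cont01_bounded cp.
have m2 : 0 < m / 2 by rewrite divr_gt0.
have [N N0 hN] := @inv_pow_taylor (m / 2)^-1 k.+1 ltac:(by rewrite invr_ge0 ltW).
have MN : 0 < M * N + 1 by rewrite ltr_wpDl ?mulr_ge0 // ltW.
exists (Num.min (m / 2) (e / (M * N + 1))); first by rewrite lt_min m2 divr_gt0.
move=> y; rewrite lt_min => /andP[y1 y2].
have hy t : 0 <= t <= 1 -> m / 2 <= nc (gam t - y).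
  move=> /hm h; have := ncBd (gam t - z) (gam t - y).
  have -> : gam t - z - (gam t - y) = y - z by ring.
  by lra.
have hz t : 0 <= t <= 1 -> m / 2 <= nc (gam t - z) by move=> /hm; lra.
have cz j := cont01_edgeK j m0 cp cg hm.
have cy j := cont01_edgeK j m2 cp cg hy.
have c3 : cont01 (fun t => k.+1%:R * (y - z) * (phi t * (gam t - z)^-1 ^+ k.+2)).
  by apply: cont01M => //; exact: cont01_cst.
have -> : edgeK phi gam k y - edgeK phi gam k z -
    k.+1%:R * edgeK phi gam k.+1 z * (y - z) =
    int01 (fun t => phi t * (gam t - y)^-1 ^+ k.+1 - phi t * (gam t - z)^-1 ^+ k.+1 -
      k.+1%:R * (y - z) * (phi t * (gam t - z)^-1 ^+ k.+2)).
  rewrite (int01B (cont01B (cy _) (cz _)) c3) (int01B (cy _) (cz _)) (int01Z _ (cz _)).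
  by rewrite /edgeK mulrAC.
apply: le_trans (int01_le (M := M * (N * nc (y - z) ^+ 2)) _ _) _.
- by apply: cont01B => //; exact: cont01B.
- move=> t t01; rewrite -mulrBr mulrCA -mulrBr ncM ler_pM ?nc_ge0 //; first exact: hM.
  apply: hN; [exact: (nc_inv_le m2 (hz t t01))|exact: (nc_inv_le m2 (hy t t01))|].
  rewrite inv_sub ?(nc_neq0 m2 (hz t t01)) ?(nc_neq0 m2 (hy t t01)) //.
  by rewrite (mulrAC _ _^-1); congr (_ * _ * _); ring.
rewrite expr2 !mulrA ler_wpM2r ?nc_ge0 //.
rewrite ltr_pdivlMr // mulrC in y2.
apply: le_trans _ (ltW y2); rewrite ler_wpM2r ?nc_ge0 //; lra.
Qed.


(** Abel summation. It turns a sum over squares of differences between opposite sides into a sum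
    over sides, weighted by the jumps of [chi]. *)
Lemma sum_by_parts (chi : nat -> C) (H : nat -> C) n : chi 0%N = 0 -> chi n = 0 ->
  \sum_(j < n) chi j * (H j - H j.+1) = \sum_(j < n) (chi j.+1 - chi j) * H j.+1.
Proof.
move=> c0 cn.
have E : \sum_(j < n) chi j * H j = \sum_(j < n) chi j.+1 * H j.+1.
  have : \sum_(j < n.+1) chi j * H j = chi 0%N * H 0%N + \sum_(j < n) chi j.+1 * H j.+1.
    by rewrite big_ord_recl.
  by rewrite big_ord_recr /= cn c0 !mul0r addr0 add0r.
transitivity (\sum_(j < n) chi j * H j - \sum_(j < n) chi j * H j.+1).
  by rewrite -sumrB; apply: eq_bigr => j _; rewrite mulrBr.
by rewrite E -sumrB; apply: eq_bigr => j _; rewrite mulrBl.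
Qed.

Lemma grid_index (u d : R) n : 0 <= u -> u < n%:R * d ->
  exists2 i, (i < n)%N & i%:R * d <= u < i.+1%:R * d.
Proof.
move=> u0; elim: n => [|n IH]; first by rewrite mul0r ltNge u0.
move=> un; have [/IH[i ni hi]|h] := ltP u (n%:R * d); first by exists i => //; rewrite ltnW.
by exists n => //; rewrite h.
Qed.

(** Extends Cauchy's formula from open squares to points on the grid lines, approached along a
    ray. *)
Lemma eq_at_limit (F G : C -> C) z v : {for z, continuous F} -> {for z, continuous G} ->
  (exists2 t0 : R, 0 < t0 & forall t : R, 0 < t -> t < t0 -> F (z + t%:C%C * v) = G (z + t%:C%C * v)) ->
  F z = G z.
Proof.
move=> /contCP cF /contCP cG [t0 t00 FG].
apply/eqP; rewrite -subr_eq0 -nc_eq0 eq_le nc_ge0 andbT; apply: le_eps => e e0.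
have [d1 d10 h1] := cF (e / 2) ltac:(by rewrite divr_gt0).
have [d2 d20 h2] := cG (e / 2) ltac:(by rewrite divr_gt0).
have v1 : 0 < nc v + 1 by have := nc_ge0 v; lra.
pose r := Num.min t0 (Num.min d1 d2 / (nc v + 1)).
have r0 : 0 < r by rewrite lt_min t00 divr_gt0 // lt_min d10.
pose t := r / 2; have t1 : 0 < t by rewrite divr_gt0.
have tr : t < r by rewrite ltr_pdivrMr // ltr_pMr // ltr1n.
have [tt0 td] : t < t0 /\ t < Num.min d1 d2 / (nc v + 1).
  by move: tr; rewrite lt_min => /andP.
have tv : nc (z + t%:C%C * v - z) < Num.min d1 d2.
  rewrite addrAC subrr add0r ncM nc_real ger0_norm ?ltW //.
  rewrite ltr_pdivlMr // in td; apply: le_lt_trans td.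
  by rewrite ler_wpM2l ?ltW //; lra.
move: tv; rewrite lt_min => /andP[/h1 l1 /h2 l2].
rewrite FG // in l1.
set p := G (z + _) in l1 l2.
rewrite (_ : F z - G z = (p - G z) - (p - F z)); last by ring.
by have := ncB (p - G z) (p - F z); lra.
Qed.


(* [(c, a, b)] encodes the segment from [a] to [a + b] with weight [c]. *)
Definition epath (e : C * C * C) (t : R) : C := e.1.2 + t%:C%C * e.2.

Lemma cont01_epath e : cont01 (epath e).
Proof.
apply: cont01D; first exact: cont01_cst.
by apply: cont01M; [exact: cont01_id|exact: cont01_cst].
Qed.

Lemma edgeK_cont phi gam k z m : 0 < m -> cont01 phi -> cont01 gam ->
  (forall t, 0 <= t <= 1 -> m <= nc (gam t - z)) -> {for z, continuous (edgeK phi gam k)}.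
Proof.
move=> m0 cp cg hm; have h := edgeK_derive k m0 cp cg hm.
by apply: derivable_contC; exact: ex_derive.
Qed.

Lemma seg_edgeK f (al : C) a b z :
  al * seg (fun w => f w * (w - z)^-1) a b =
  al * b * edgeK (fun t => f (epath (al * b, a, b) t)) (epath (al * b, a, b)) 0 z.
Proof.
by rewrite mulrA; congr (_ * _); apply: eq_int01 => t _; rewrite expr1.
Qed.

(** * The boundary of a union of grid squares *)

Section Grid.
(** A square that meets the [dl]-neighbourhood of [K] has diameter at most [2 * dl], so it lies
    within [4 * dl] of [K], hence in [V]. As [L] exceeds [M] by [2 * dl] and the grid reaches beyond
    [L], squares with an index [0] or [n] miss that neighbourhood, and Abel summation has no
    boundary terms. *)
Variables (K V : set C) (f : C -> C) (dl M L : R) (n : nat).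
Hypotheses (dl0 : 0 < dl) (dV : forall k w, K k -> nc (w - k) < 4 * dl -> V w).
Hypotheses (KM : forall k, K k -> nc k <= M) (fV : holomorphic_on V f).
Hypotheses (LM : L = M + 2 * dl) (nL : 2 * L < n%:R * dl).

Let cor i j : C := Complex (- L + i%:R * dl) (- L + j%:R * dl).
Let K1 : set C := [set z | exists2 k, K k & nc (z - k) < dl].
(** Squares are selected for meeting [K1] rather than [K]: a side between a selected and a rejected
    square then avoids [K1] and so keeps the distance [dl] from [K]. *)
Let chi i j : C := if `[< exists2 z, csq (cor i j) dl z & K1 z >] then 1 else 0.

Let chiP i j : (chi i j = 1 /\ csq (cor i j) dl `<=` V) \/
  (chi i j = 0 /\ forall w, csq (cor i j) dl w -> ~ K1 w).
Proof.
rewrite /chi; case: asboolP => [[z zQ [k kK zk]]|h]; [left|right]; split=> //.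
  move=> w wQ; apply: (dV kK); have := csq_diam wQ zQ.
  by have := ncD (w - z) (z - k); rewrite subrKA; move: dl0; lra.
by move=> w wQ wK; apply: h; exists w.
Qed.

Let K1_box z : K1 z -> [/\ - L + dl < cRe z, cRe z < L, - L + dl < cIm z & cIm z < L].
Proof.
move=> [k /KM kM zk]; have := ncD (z - k) k; rewrite subrK => h.
have zM : nc z < M + dl by lra.
have := le_lt_trans (Re_le_nc z) zM; have := le_lt_trans (Im_le_nc z) zM.
by have dp := dl0; rewrite !ltr_norml LM => /andP[? ?] /andP[? ?]; split; lra.
Qed.

Let chi0 j : chi 0%N j = 0 /\ chi n j = 0 /\ chi j 0%N = 0 /\ chi j n = 0.
Proof.
suff aux i j' : ~ (exists2 z, csq (cor i j') dl z & K1 z) -> chi i j' = 0.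
  do ![split]; apply: aux => -[z [/andP[x1 x2] /andP[y1 y2]] /K1_box[? ? ? ?]];
    rewrite /= in x1 x2 y1 y2; move: nL; rewrite ?mul0r in x1 x2 y1 y2; lra.
by rewrite /chi => h; case: asboolP.
Qed.

Let corS i j : cor i.+1 j = cor i j + dl%:C%C /\ cor i j.+1 = cor i j + 'i%C * dl%:C%C.
Proof. by split; rewrite /cor -natr1; simpc; congr (_ +i* _)%C; ring. Qed.

Let cell_uniq (i i' : nat) (u : R) : i%:R * dl < u < i.+1%:R * dl ->
  i'%:R * dl <= u <= i'.+1%:R * dl -> i = i'.
Proof.
move=> /andP[h1 h2] /andP[h3 h4]; apply/eqP; rewrite eqn_leq; apply/andP; split.
  by rewrite -ltnS -(ltr_nat R) -(ltr_pM2r dl0) (lt_le_trans h1 h4).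
by rewrite -ltnS -(ltr_nat R) -(ltr_pM2r dl0) (le_lt_trans h3 h2).
Qed.

(** Only the open square around [zeta] contributes. The point [z] ensures that this square is
    selected; [zeta], obtained by moving off the grid lines, may lie outside [K1]. *)
Lemma grid_sum i j z (zeta : C) : (i < n)%N -> (j < n)%N -> K1 z -> csq (cor i j) dl z ->
  csqo (cor i j) dl zeta ->
  \sum_(i < n) \sum_(j < n) chi i j * oint (fun w => f w * (w - zeta)^-1) (cor i j) dl%:C%C =
  f zeta * cpi.
Proof.
move=> ni nj zK zQ zo.
have [c1|[c0 /(_ z zQ)]] := chiP i j; last by [].
rewrite (bigD1 (Ordinal ni)) //= (bigD1 (Ordinal nj)) //= c1.1 mul1r.
rewrite cauchy_in //; last by move=> w /c1.2 /fV.
have others i' j' : (i', j') <> (i, j) ->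
    chi i' j' * oint (fun w => f w * (w - zeta)^-1) (cor i' j') dl%:C%C = 0.
  move=> ne; have [[_ h]|[-> _]] := chiP i' j'; last by rewrite mul0r.
  rewrite cauchy_out ?mulr0 //; last by move=> w /h /fV.
  move=> [/andP[x1 x2] /andP[y1 y2]]; apply: ne.
  case: zo => /andP[x3 x4] /andP[y3 y4]; rewrite /= in x1 x2 x3 x4 y1 y2 y3 y4.
  have e1 k : k.+1%:R * dl = k%:R * dl + dl by rewrite -natr1; ring.
  congr pair; apply/esym.
    by apply: (cell_uniq (u := cRe zeta + L)); rewrite e1; apply/andP; split; lra.
  by apply: (cell_uniq (u := cIm zeta + L)); rewrite e1; apply/andP; split; lra.
rewrite big1 ?addr0; last first.
  by move=> j' /eqP jj; apply: others => -[e]; apply: jj; apply: val_inj.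
rewrite big1 ?addr0 // => i' /eqP ii; rewrite big1 // => j' _.
by apply: others => -[e _]; apply: ii; apply: val_inj.
Qed.

(** An edge carries its displacement times the jump of [chi] between the two squares it separates,
    signed by orientation. *)
Let hedge (p : 'I_n * 'I_n) : C * C * C :=
  ((chi p.1 p.2.+1 - chi p.1 p.2) * dl%:C%C, cor p.1 p.2.+1, dl%:C%C).
Let vedge (p : 'I_n * 'I_n) : C * C * C :=
  ((chi p.1 p.2 - chi p.1.+1 p.2) * ('i%C * dl%:C%C), cor p.1.+1 p.2, 'i%C * dl%:C%C).

(** Edges of weight zero are removed, since they may meet [K]. *)
Definition grid_edges : seq (C * C * C) :=
  [seq e <- [seq hedge p | p : 'I_n * 'I_n] ++ [seq vedge p | p : 'I_n * 'I_n] | e.1.1 != 0].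

(** The edge belongs to two closed squares of which exactly one is selected: that one lies in [V],
    the other avoids [K1]. *)
Lemma grid_edgesP e t : e \in grid_edges -> 0 <= t <= 1 ->
  V (epath e t) /\ forall k, K k -> dl <= nc (epath e t - k).
Proof.
rewrite mem_filter => /andP[e0 eE] t01.
have dl0' := ltW dl0.
have key i j i' j' : chi i j != chi i' j' -> csq (cor i j) dl (epath e t) ->
    csq (cor i' j') dl (epath e t) -> V (epath e t) /\ ~ K1 (epath e t).
  move=> ne q q'; case: (chiP i j) (chiP i' j') => [[c h]|[c h]] [[c' h']|[c' h']].
  - by rewrite c c' eqxx in ne.
  - by split; [exact: h|exact: h'].
  - by split; [exact: h'|exact: h].
  - by rewrite c c' eqxx in ne.
suff [h1 h2] : V (epath e t) /\ ~ K1 (epath e t).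
  by split=> // k kK; rewrite leNgt; apply/negP => h; apply: h2; exists k.
move: eE; rewrite mem_cat => /orP[] /mapP[p _ eE]; move: e0 key; rewrite {e}eE /= /epath /=;
  rewrite mulf_eq0 negb_or subr_eq0 => /andP[ne _] key.
  apply: (key _ _ _ _ ne); first by have [[]] := sqb_edges (cor p.1 p.2.+1) dl0' t01.
  by rewrite (corS _ _).2; have [_ _ []] := sqb_edges (cor p.1 p.2) dl0' t01.
apply: (key _ _ _ _ ne); last by have [_ _ _ []] := sqb_edges (cor p.1.+1 p.2) dl0' t01.
by rewrite (corS _ _).1; have [_ []] := sqb_edges (cor p.1 p.2) dl0' t01.
Qed.

Lemma grid_edges_sum (zeta : C) :
  \sum_(i < n) \sum_(j < n) chi i j * oint (fun w => f w * (w - zeta)^-1) (cor i j) dl%:C%C =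
  \sum_(e <- grid_edges) e.1.1 * edgeK (f \o epath e) (epath e) 0 zeta.
Proof.
rewrite /grid_edges big_filter.
rewrite [RHS](_ : _ = \sum_(e <- [seq hedge p | p : 'I_n * 'I_n] ++ [seq vedge p | p : 'I_n * 'I_n])
  e.1.1 * edgeK (f \o epath e) (epath e) 0 zeta); last first.
  rewrite big_mkcond; apply: eq_bigr => e _.
  by case: eqP => [->|//]; rewrite mul0r.
set g := fun w => f w * (w - zeta)^-1.
rewrite big_cat /= !big_image /=.
have hE : \sum_(p : 'I_n * 'I_n) (hedge p).1.1 * edgeK (f \o epath (hedge p)) (epath (hedge p)) 0 zeta =
    \sum_(i < n) \sum_(j < n) (chi i j.+1 - chi i j) * seg g (cor i j.+1) dl%:C%C.
  by rewrite pair_bigA; apply: eq_bigr => -[i j] _; exact/esym/seg_edgeK.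
have vE : \sum_(p : 'I_n * 'I_n) (vedge p).1.1 * edgeK (f \o epath (vedge p)) (epath (vedge p)) 0 zeta =
    \sum_(i < n) \sum_(j < n) (chi i j - chi i.+1 j) * seg g (cor i.+1 j) ('i%C * dl%:C%C).
  by rewrite pair_bigA; apply: eq_bigr => -[i j] _; exact/esym/seg_edgeK.
rewrite hE vE {hE vE}.
rewrite [X in _ = _ + X]exchange_big /=.
rewrite (eq_bigr (fun i : 'I_n => \sum_(j < n) chi i j * (seg g (cor i j) dl%:C%C - seg g (cor i j.+1) dl%:C%C) +
   \sum_(j < n) chi i j * (seg g (cor i.+1 j) ('i%C * dl%:C%C) - seg g (cor i j) ('i%C * dl%:C%C)))); last first.
  move=> i _; rewrite -big_split; apply: eq_bigr => j _ /=.
  by rewrite (corS _ _).1 (corS _ _).2 /oint; ring.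
rewrite big_split /=; congr (_ + _).
  apply: eq_bigr => i _.
  apply: (sum_by_parts (chi := chi i) (fun j => seg g (cor i j) dl%:C%C));
    by have [_ [_ [? ?]]] := chi0 i.
rewrite exchange_big; apply: eq_bigr => j _ /=.
(* The sign turns [H j - H j.+1] into right side minus left side. *)
have := @sum_by_parts (fun i => chi i j) (fun i => - seg g (cor i j) ('i%C * dl%:C%C)) n
  (chi0 j).1 (chi0 j).2.1.
rewrite (eq_bigr (fun i : 'I_n => chi i j * (seg g (cor i.+1 j) ('i%C * dl%:C%C) - seg g (cor i j) ('i%C * dl%:C%C)))) => [->|i _].
  by apply: eq_bigr => i _; ring.
by ring.
Qed.

Lemma grid_rep k z : K k -> nc (z - k) < dl ->
  f z * cpi = \sum_(e <- grid_edges) e.1.1 * edgeK (f \o epath e) (epath e) 0 z.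
Proof.
move=> kK zk; have zK : K1 z by exists k.
have dp := dl0; have LE := LM; have nL' := nL.
have [x1 x2 y1 y2] := K1_box zK.
have [i ni /andP[i1 i2]] := @grid_index (cRe z + L) dl n ltac:(by lra) ltac:(by lra).
have [j nj /andP[j1 j2]] := @grid_index (cIm z + L) dl n ltac:(by lra) ltac:(by lra).
have e1 l : l.+1%:R * dl = l%:R * dl + dl by rewrite -natr1; ring.
rewrite e1 in i2; rewrite e1 in j2.
have zQ : csq (cor i j) dl z by split; apply/andP; split => /=; lra.
pose m := dl - nc (z - k).
have m0 : 0 < m by rewrite subr_gt0.
have hm e t : e \in grid_edges -> 0 <= t <= 1 -> m <= nc (epath e t - z).
  move=> eE t01; have := (grid_edgesP eE t01).2 k kK.
  have := ncD (epath e t - z) (z - k); rewrite subrKA /m; lra.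
have cf e : e \in grid_edges -> cont01 (f \o epath e).
  move=> eE; apply: (cont01_comp (f := f)); first exact: cont01_epath.
  by move=> t t01; apply/derivable_contC/fV; have [] := grid_edgesP eE t01.
(* The square found for [z] may have [z] on its left or lower side; a small displacement along
   [1 + i] enters its interior. *)
apply: (@eq_at_limit (fun z => f z * cpi)
  (fun z => \sum_(e <- grid_edges) e.1.1 * edgeK (f \o epath e) (epath e) 0 z) z (Complex 1 1)).
- have fz : {for z, continuous f}.
    by apply/derivable_contC/fV/(dV kK); lra.
  exact (continuousM fz (@cst_continuous _ _ cpi z)).
- rewrite (_ : (fun z => _) = \sum_(e <- grid_edges) (fun z => e.1.1 * edgeK (f \o epath e) (epath e) 0 z)); last first.
    by apply/funext => w; rewrite fct_sumE.
  rewrite big_seq; elim/big_ind : _ => [|F G cF cG|e eE].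
  + exact: cst_continuous.
  + exact (continuousD cF cG).
  + exact (continuousM (@cst_continuous _ _ e.1.1 z) (edgeK_cont m0 (cf e eE) (cont01_epath e) (fun t => hm e t eE))).
pose t0 := Num.min (i%:R * dl + dl - (cRe z + L)) (j%:R * dl + dl - (cIm z + L)).
exists t0; first by rewrite lt_min !subr_gt0 i2 j2.
move=> t tp; rewrite lt_min => /andP[t1 t2].
rewrite -grid_edges_sum (grid_sum ni nj zK zQ) //.
by move: (z) i1 i2 j1 j2 t1 t2 => [x y] /= *; split; apply/andP; split; rewrite /= ?simpm /=; lra.
Qed.

End Grid.

(* The edges bound the union of the squares of a fine grid that come close to [K];
   interior edges cancel by summation by parts. *)
Lemma cauchy_edges (K V : set C) f : compact K -> open V -> K `<=` V -> holomorphic_on V f ->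
  exists (E : seq (C * C * C)) (rho : R), [/\ 0 < rho,
    forall e t, e \in E -> 0 <= t <= 1 ->
      V (epath e t) /\ forall k, K k -> rho <= nc (epath e t - k) &
    forall k z, K k -> nc (z - k) < rho ->
      f z = \sum_(e <- E) e.1.1 / cpi * edgeK (f \o epath e) (epath e) 0 z].
Proof.
move=> cK oV KV fV; have [d d0 hd] := compact_dist_open cK oV KV.
have [M M0 hM] := compact_boundedC cK.
have dl0 : 0 < d / 4 by rewrite divr_gt0.
have hV k w : K k -> nc (w - k) < 4 * (d / 4) -> V w.
  by move=> kK wk; apply: (hd k w kK); lra.
pose L := M + 2 * (d / 4).
pose n := (Num.bound (2 * L / (d / 4))).
have nL : 2 * L < n%:R * (d / 4).
  rewrite -ltr_pdivrMr //; apply: archi_boundP.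
  by rewrite divr_ge0 ?mulr_ge0 // ?addr_ge0 // ?mulr_ge0 // ltW.
exists (grid_edges K (d / 4) L n), (d / 4); split=> //.
  by move=> e t; exact (grid_edgesP dl0 hV (e := e) (t := t)).
move=> k z kK zk; apply: (mulIf cpi_neq0); rewrite (grid_rep dl0 hV hM fV erefl nL kK zk).
rewrite mulr_suml; apply: eq_bigr => e _.
by rewrite mulrAC divfK // cpi_neq0.
Qed.

End CauchyKernel.

(** * Taylor jets *)

Section TaylorJets.
Context {R : realType}.
Local Notation C := R[i].
Implicit Types (f g : C -> C) (x y z w : C) (a b : nat -> C -> C).

(* [a k] is the [k]-th Taylor coefficient [f^(k) / k!] as a function near [z]. *)
Definition tjet f z a := (\forall y \near z, f y = a 0%N y) /\
  forall k : nat, \forall y \near z, is_derive (y : C) (1 : C) (a k) (k.+1%:R * a k.+1 y).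

(** Stands for holomorphy near [z]. A whole jet is kept as witness, so that sums and products reduce
    to algebra on coefficients. *)
Definition smooth f z := exists a, tjet f z a.

(** Dividing by the factorial turns the Leibniz rule into a Cauchy product; the submultiplicativity
    of [tnorm] rests on this. *)
Definition tay f z k : C := derive1n k f z / k`!%:R.

Lemma near_nearC z (P : C -> Prop) :
  (\forall y \near z, P y) -> \forall y \near z, \forall x \near y, P x.
Proof. by move=> h; exact: (near_join h). Qed.

Lemma near_allC z (P : C -> Prop) : (forall y, P y) -> \forall y \near z, P y.
Proof. by move=> h; apply: (filterS _ (@filterT _ (nbhs z) _)) => y _. Qed.

Lemma tjet_derive1n f z a k : tjet f z a ->
  \forall y \near z, derive1n k f y = k`!%:R * a k y.
Proof.
move=> [f0 da]; elim: k => [|k IH]; first by apply: filterS f0 => y e; rewrite fact0 mul1r -e.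
have h1 := near_nearC IH; have h2 := da k.
apply: filterS2 h1 h2 => y e d.
rewrite derive1nS derive1E (near_eq_derive _ e).
have h : is_derive y 1 (fun x => k`!%:R * a k x) (k`!%:R * (k.+1%:R * a k.+1 y)).
  exact: (is_deriveZ (k`!%:R) d).
by rewrite derive_val mulrA -natrM mulnC factS.
Qed.

Lemma tjet_derivable f z a k : tjet f z a ->
  \forall y \near z, derivable (derive1n k f) y 1.
Proof.
move=> h; have h1 := near_nearC (tjet_derive1n k h).
apply: filterS2 h1 (h.2 k) => y e d.
apply: (near_eq_derivable (f := fun x => k`!%:R * a k x)).
  by apply: filterS e => x ->.
have h' : is_derive y 1 (fun x => k`!%:R * a k x) (k`!%:R * (k.+1%:R * a k.+1 y)).
  exact: (is_deriveZ (k`!%:R) d).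
exact: ex_derive.
Qed.

Lemma natf_neq0 n : (n`!%:R : C) != 0.
Proof. by rewrite pnatr_eq0 -lt0n fact_gt0. Qed.

Lemma tjet_tay f z a k : tjet f z a -> tay f z k = a k z.
Proof.
move=> h; rewrite /tay (nbhs_singleton (tjet_derive1n k h)).
by rewrite mulrAC divff ?mul1r // natf_neq0.
Qed.

Lemma tjet_near f g z a : (\forall y \near z, f y = g y) -> tjet f z a -> tjet g z a.
Proof. by move=> fg [f0 da]; split => //; apply: filterS2 fg f0 => y ->. Qed.

Lemma tjet_cst c z : tjet (fun=> c) z (fun k _ => if k is 0%N then c else 0).
Proof.
split; first by apply: near_allC.
by move=> k; apply: near_allC => y; rewrite mulr0; case: k => [|k]; exact: is_derive_cst.
Qed.

Lemma tjet_id z : tjet id z (fun k y => match k with 0%N => y | 1%N => 1 | _ => 0 end).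
Proof.
split; first by apply: near_allC.
move=> k; apply: near_allC => y.
case: k => [|[|k]]; rewrite ?mul1r ?mulr0; [exact: is_derive_id|exact: is_derive_cst|exact: is_derive_cst].
Qed.

Lemma tjetD f g z a b : tjet f z a -> tjet g z b ->
  tjet (fun y => f y + g y) z (fun k y => a k y + b k y).
Proof.
move=> [f0 da] [g0 db]; split; first by apply: filterS2 f0 g0 => y -> ->.
move=> k; apply: filterS2 (da k) (db k) => y d1 d2.
by rewrite mulrDr; exact: is_deriveD.
Qed.

Definition cauchy_prod a b k y : C := \sum_(i < k.+1) a i y * b (k - i)%N y.

(** In the derivative of the sum of the [a i * b (k - i)], the product [a i * b (k.+1 - i)] occurs
    with the weights [k.+1 - i] and [i], which add up to [k.+1]. *)
Lemma tjetM f g z a b : tjet f z a -> tjet g z b ->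
  tjet (fun y => f y * g y) z (cauchy_prod a b).
Proof.
move=> [f0 da] [g0 db]; split.
  by apply: filterS2 f0 g0 => y -> ->; rewrite /cauchy_prod big_ord1.
move=> k.
have hda : \forall y \near z, forall i : 'I_k.+1, is_derive (y : C) (1 : C) (a i) (i.+1%:R * a i.+1 y).
  apply: (@filter_forall _ _ (fun (i : 'I_k.+1) (y : C) =>
    is_derive (y : C) (1 : C) (a i) (i.+1%:R * a i.+1 y)) (nbhs z)) => i; exact: da.
have hdb : \forall y \near z, forall i : 'I_k.+1, is_derive (y : C) (1 : C) (b i) (i.+1%:R * b i.+1 y).
  apply: (@filter_forall _ _ (fun (i : 'I_k.+1) (y : C) =>
    is_derive (y : C) (1 : C) (b i) (i.+1%:R * b i.+1 y)) (nbhs z)) => i; exact: db.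
apply: filterS2 hda hdb => y d1 d2.
rewrite (_ : cauchy_prod a b k = \sum_(i < k.+1) (fun y => a i y * b (k - i)%N y)); last first.
  by apply/funext => x; rewrite fct_sumE.
pose D (i : 'I_k.+1) := a i y * ((k - i).+1%:R * b (k - i).+1 y) + b (k - i)%N y * (i.+1%:R * a i.+1 y).
have dD : is_derive y 1 (\sum_(i < k.+1) (fun y => a i y * b (k - i)%N y)) (\sum_(i < k.+1) D i).
  apply: is_derive_sum => i.
  have ki : (k - i < k.+1)%N by rewrite ltnS leq_subr.
  exact: (is_deriveM (d1 i) (d2 (Ordinal ki))).
apply: is_derive_eq dD _.
rewrite /D big_split /=.
have E1 : \sum_(i < k.+1) a i y * ((k - i).+1%:R * b (k - i).+1 y) =
    \sum_(i < k.+2) (k.+1 - i)%N%:R * (a i y * b (k.+1 - i)%N y).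
  rewrite [RHS]big_ord_recr /= subnn mul0r addr0; apply: eq_bigr => i _.
  by rewrite subSn ?leq_ord // mulrCA.
have E2 : \sum_(i < k.+1) b (k - i)%N y * (i.+1%:R * a i.+1 y) =
    \sum_(i < k.+2) i%:R * (a i y * b (k.+1 - i)%N y).
  rewrite [RHS]big_ord_recl /= mul0r add0r; apply: eq_bigr => i _.
  by rewrite /bump /= add1n subSS mulrCA [X in _ * X]mulrC.
rewrite E1 E2 -big_split /cauchy_prod mulr_sumr; apply: eq_bigr => i _ /=.
by rewrite -mulrDl -natrD subnK // -ltnS ltn_ord.
Qed.

Lemma smooth_near f g z : (\forall y \near z, f y = g y) -> smooth f z -> smooth g z.
Proof. by move=> fg [a ha]; exists a; exact: tjet_near ha. Qed.

Lemma smooth_cst c z : smooth (fun=> c) z.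
Proof. by eexists; exact: tjet_cst. Qed.

Lemma smooth_id z : smooth id z. Proof. by eexists; exact: tjet_id. Qed.

Lemma smoothD f g z : smooth f z -> smooth g z -> smooth (fun y => f y + g y) z.
Proof. by move=> [a ha] [b hb]; eexists; exact: (tjetD ha hb). Qed.

Lemma smoothM f g z : smooth f z -> smooth g z -> smooth (fun y => f y * g y) z.
Proof. by move=> [a ha] [b hb]; eexists; exact: (tjetM ha hb). Qed.

Lemma smoothN f z : smooth f z -> smooth (fun y => - f y) z.
Proof.
move=> h; rewrite (_ : (fun y => _) = fun y => (-1) * f y).
  by apply: smoothM => //; exact: smooth_cst.
by apply/funext => y; rewrite mulN1r.
Qed.

Lemma smoothB f g z : smooth f z -> smooth g z -> smooth (fun y => f y - g y) z.
Proof. by move=> hf hg; apply: smoothD => //; exact: smoothN. Qed.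

Lemma tay_near f g z k : smooth f z -> (\forall y \near z, f y = g y) -> tay f z k = tay g z k.
Proof. by move=> [a ha] fg; rewrite (tjet_tay _ ha) (tjet_tay _ (tjet_near fg ha)). Qed.

(** * The seminorm of Taylor coefficients *)

Definition tnorm N f z : R := \sum_(k < N.+1) nc (tay f z k).

Lemma tnorm_jet N f z a : tjet f z a -> tnorm N f z = \sum_(k < N.+1) nc (a k z).
Proof. by move=> h; apply: eq_bigr => k _; rewrite (tjet_tay _ h). Qed.

Lemma tnorm_near N f g z : smooth f z -> (\forall y \near z, f y = g y) ->
  tnorm N f z = tnorm N g z.
Proof. by move=> sf fg; apply: eq_bigr => k _; rewrite (tay_near _ sf fg). Qed.

Lemma tnorm_ge0 N f z : 0 <= tnorm N f z.
Proof. by apply: sumr_ge0 => k _; exact: nc_ge0. Qed.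

Lemma tnormD N f g z : smooth f z -> smooth g z ->
  tnorm N (fun y => f y + g y) z <= tnorm N f z + tnorm N g z.
Proof.
move=> [a ha] [b hb]; rewrite (tnorm_jet _ ha) (tnorm_jet _ hb) (tnorm_jet _ (tjetD ha hb)).
by rewrite -big_split; apply: ler_sum => k _; exact: ncD.
Qed.

(** The left side collects those terms [u i * v j] of the product for which [i + j <= N]; the others
    are nonnegative. *)
Lemma cauchy_prod_le N (u v : nat -> R) : (forall k, 0 <= u k) -> (forall k, 0 <= v k) ->
  \sum_(k < N.+1) \sum_(i < k.+1) u i * v (k - i)%N <=
  (\sum_(k < N.+1) u k) * (\sum_(k < N.+1) v k).
Proof.
move=> u0 v0.
have -> : \sum_(k < N.+1) \sum_(i < k.+1) u i * v (k - i)%N =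
    \sum_(i < N.+1) u i * \sum_(k < N.+1 | (i <= k)%N) v (k - i)%N.
  rewrite (eq_bigr (fun k : 'I_N.+1 => \sum_(i < N.+1 | (i <= k)%N) u i * v (k - i)%N)); last first.
    move=> k _; rewrite (big_ord_widen N.+1 (fun i => u i * v (k - i)%N) (ltn_ord k)).
    by apply: eq_bigl => i; rewrite ltnS.
  rewrite (exchange_big_dep predT) //=; apply: eq_bigr => i _.
  by rewrite mulr_sumr.
rewrite mulr_suml; apply: ler_sum => i _; apply: ler_wpM2l => //.
rewrite -(big_mkord (fun k => (i <= k)%N) (fun k => v (k - i)%N)).
rewrite -(big_mkord predT v) (big_cat_nat (n := i)) //=; last exact: ltnW.
rewrite big_nat_cond big_pred0 ?add0r; last first.
  by move=> k; case: ltnP => //; rewrite ?andbF ltnNge => ->.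
rewrite big_nat_cond (eq_bigl (fun k => (i <= k < N.+1)%N && true)); last first.
  by move=> k; case: (i <= k)%N; rewrite ?andbT.
rewrite -big_nat_cond -{1}[nat_of_ord i]add0n big_addn.
under eq_bigr do rewrite addnK.
rewrite [leRHS](big_cat_nat (n := (N.+1 - i)%N)) ?leq_subr //= lerDl.
by apply: sumr_ge0.
Qed.

Lemma tnormM N f g z : smooth f z -> smooth g z ->
  tnorm N (fun y => f y * g y) z <= tnorm N f z * tnorm N g z.
Proof.
move=> [a ha] [b hb]; rewrite (tnorm_jet _ ha) (tnorm_jet _ hb) (tnorm_jet _ (tjetM ha hb)).
apply: le_trans (cauchy_prod_le N (u := fun k => nc (a k z)) (v := fun k => nc (b k z)) _ _);
  [|by move=> k; exact: nc_ge0..].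
apply: ler_sum => k _; apply: le_trans (nc_sum _ _ _) _.
by apply: ler_sum => i _; rewrite ncM.
Qed.

Lemma tnorm_cst N c z : tnorm N (fun=> c) z = nc c.
Proof.
rewrite (tnorm_jet _ (tjet_cst c z)) big_ord_recl /= big1 ?addr0 // => i _.
exact: nc0.
Qed.

Lemma tnorm_id N z : tnorm N id z <= nc z + 1.
Proof.
rewrite (tnorm_jet _ (tjet_id z)) big_ord_recl /= lerD2l.
under eq_bigr do rewrite add0n.
case: N => [|N]; first by rewrite big_ord0.
rewrite big_ord_recl; apply: le_trans (_ : 1 + 0 <= 1); last by rewrite addr0.
apply: lerD; first by change (nc (1 : C) <= 1); rewrite nc1.
by rewrite big1 // => i _; exact: nc0.
Qed.

Lemma tnormZ N c f z : smooth f z -> tnorm N (fun y => c * f y) z <= nc c * tnorm N f z.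
Proof. by move=> sf; rewrite -(tnorm_cst N c z) tnormM //; exact: smooth_cst. Qed.

Lemma tnormN N f z : smooth f z -> tnorm N (fun y => - f y) z <= tnorm N f z.
Proof.
move=> sf; rewrite (_ : (fun y => _) = fun y => (-1) * f y).
  by apply: le_trans (tnormZ _ _ sf) _; rewrite ncN nc1 mul1r.
by apply/funext => y; rewrite mulN1r.
Qed.

Lemma tnormB N f g z : smooth f z -> smooth g z ->
  tnorm N (fun y => f y - g y) z <= tnorm N f z + tnorm N g z.
Proof.
move=> sf sg; apply: le_trans (tnormD _ sf (smoothN sg)) _.
by rewrite lerD2l tnormN.
Qed.

Lemma tjet_edgeK phi gam z m : 0 < m -> cont01 phi -> cont01 gam ->
  (forall t : R, 0 <= t <= 1 -> m <= nc (gam t - z)) ->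
  tjet (edgeK phi gam 0) z (edgeK phi gam).
Proof.
move=> m0 cp cg hm; split; first by apply: near_allC.
move=> k; apply/nbhsCP; have m2 : 0 < m / 2 by rewrite divr_gt0.
exists (m / 2) => // y yz; apply: (edgeK_derive k m2 cp cg).
move=> t /hm h; have := ncD (gam t - y) (y - z); rewrite subrKA; lra.
Qed.

Definition kern w y : C := (w - y)^-1.

(** The kernel is the Cauchy integral of 1 along the constant path [w]. *)
Lemma tjet_kern w z : w != z -> tjet (kern w) z (fun k y => kern w y ^+ k.+1).
Proof.
move=> wz; have m0 : 0 < nc (w - z) by rewrite nc_gt0 subr_eq0.
have := tjet_edgeK m0 (cont01_cst 1) (cont01_cst w) (fun t _ => lexx _).
rewrite (_ : edgeK _ _ = fun k y => kern w y ^+ k.+1); last first.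
  by apply/funext => k; apply/funext => y; rewrite /edgeK int01_cst mul1r.
by apply: tjet_near; apply: near_allC => y; rewrite expr1.
Qed.

Lemma tnorm_kern N w z (d : R) : 0 < d -> d <= nc (w - z) ->
  tnorm N (kern w) z <= \sum_(k < N.+1) d^-1 ^+ k.+1.
Proof.
move=> d0 dz; have wz : w != z by rewrite -subr_eq0 (nc_neq0 d0).
rewrite (tnorm_jet _ (tjet_kern wz)); apply: ler_sum => k _.
rewrite ncX; apply: lerXn2r; rewrite ?nnegrE ?nc_ge0 ?invr_ge0 //; first exact: ltW.
exact: (nc_inv_le d0 dz).
Qed.

Lemma smooth_kern w z : w != z -> smooth (kern w) z.
Proof. by move=> wz; eexists; exact: tjet_kern. Qed.

End TaylorJets.

(** * The algebra of approximable functions *)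

Section Approximation.
Context {R : realType}.
Local Notation C := R[i].
Implicit Types (f g h x y : C -> C) (z w : C) (p q : {poly C}) (N : nat).

Definition ratf p q z : C := p.[z] / q.[z].

Lemma smooth_cont f z : smooth f z -> {for z, continuous f}.
Proof. by move=> [a /(tjet_derivable 0)/nbhs_singleton]; exact: derivable_contC. Qed.

Lemma smooth_poly p z : smooth (horner p) z.
Proof.
elim/poly_ind: p => [|p c IH].
  rewrite (_ : horner 0 = fun=> 0); first exact: smooth_cst.
  by apply/funext => t; rewrite horner0.
rewrite (_ : horner _ = fun t => p.[t] * t + c); last first.
  by apply/funext => t; rewrite hornerMXaddC.
apply: smoothD; last exact: smooth_cst.
by apply: smoothM => //; exact: smooth_id.
Qed.

Lemma near_nonroot q z : ~~ root q z -> \forall t \near z, q.[t] != 0.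
Proof.
move=> qz; have q0 : 0 < nc q.[z] by rewrite nc_gt0.
have [d d0 hd] := (contCP _ _).1 (smooth_cont (smooth_poly q z)) _ q0.
apply/nbhsCP; exists d => // t /hd; apply: contraTneq => ->.
by rewrite sub0r ncN ltxx.
Qed.

(** Over [C] the polynomial splits, so its inverse is, up to a constant factor, a product of
    functions [- kern r]. *)
Lemma smooth_inv_poly q z : ~~ root q z -> smooth (fun t => (q.[t])^-1) z.
Proof.
have [rs ->] := closed_field_poly_normal q.
rewrite rootE hornerZ mulf_eq0 negb_or => /andP[_ h].
rewrite (_ : (fun t => _) = fun t => (lead_coef q)^-1 * ((\prod_(r <- rs) ('X - r%:P)).[t])^-1); last first.
  by apply/funext => t; rewrite hornerZ invfM.
apply: smoothM; first exact: smooth_cst.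
elim: rs h => [|r rs IH] h.
  rewrite (_ : (fun t => _) = fun=> 1); first exact: smooth_cst.
  by apply/funext => t; rewrite big_nil hornerC invr1.
move: h; rewrite big_cons hornerM mulf_eq0 negb_or hornerXsubC subr_eq0 => /andP[zr /IH h].
rewrite (_ : (fun t => _) = fun t => (- kern r t) * ((\prod_(r <- rs) ('X - r%:P)).[t])^-1); last first.
  apply/funext => t; rewrite ?big_cons hornerM hornerXsubC invfM /kern.
  by rewrite -invrN opprB.
by apply: smoothM => //; apply: smoothN; apply: smooth_kern; rewrite eq_sym.
Qed.

Lemma smooth_ratf p q z : ~~ root q z -> smooth (ratf p q) z.
Proof.
by move=> qz; apply: smoothM; [exact: smooth_poly|exact: smooth_inv_poly].
Qed.

Section Algebra.
Variables (K : set C) (L : set (sphere R)).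
Hypotheses (cK : compact K) (hL : L `<=` sphere_compl K).

(* Unlike in [rational_with_poles_in], [p] and [q] need not be coprime, which
   makes these fractions visibly closed under sums and products. *)
Definition polepair p q := [/\ q != 0, forall a, root q a -> L (Some a) &
  ((size q < size p)%N -> L None)].

Lemma pole_notin w : L (Some w) -> ~ K w.
Proof. by move=> /hL h Kw; apply: h; exists w. Qed.

Lemma polepair_nonroot p q z : polepair p q -> K z -> ~~ root q z.
Proof. by move=> [_ h _] Kz; apply/negP => /h/pole_notin. Qed.

(** At infinity by contraposition: if [None] is not in [L], neither numerator exceeds its
    denominator in size, and this passes to the product. *)
Lemma polepairM p1 q1 p2 q2 : polepair p1 q1 -> polepair p2 q2 ->
  polepair (p1 * p2) (q1 * q2).
Proof.
move=> [n1 r1 s1] [n2 r2 s2]; split.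
- by rewrite mulf_neq0.
- by move=> a; rewrite rootM => /orP[/r1|/r2].
- move=> s; apply: contrapT => nL.
  have l1 : (size p1 <= size q1)%N by rewrite leqNgt; apply/negP => /s1.
  have l2 : (size p2 <= size q2)%N by rewrite leqNgt; apply/negP => /s2.
  move: s; rewrite size_mul // ltnNge (leq_trans (size_polyMleq _ _)) //.
  by rewrite -!subn1 leq_sub2r // leq_add.
Qed.

Lemma polepairD p1 q1 p2 q2 : polepair p1 q1 -> polepair p2 q2 ->
  polepair (p1 * q2 + p2 * q1) (q1 * q2).
Proof.
move=> [n1 r1 s1] [n2 r2 s2]; split.
- by rewrite mulf_neq0.
- by move=> a; rewrite rootM => /orP[/r1|/r2].
- move=> s; apply: contrapT => nL.
  have l1 : (size p1 <= size q1)%N by rewrite leqNgt; apply/negP => /s1.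
  have l2 : (size p2 <= size q2)%N by rewrite leqNgt; apply/negP => /s2.
  move: s; rewrite size_mul // ltnNge (leq_trans (size_polyD _ _)) // geq_max.
  rewrite !(leq_trans (size_polyMleq _ _)) // -!subn1 leq_sub2r //.
    by rewrite addnC leq_add2l.
  by rewrite leq_add2r.
Qed.

(** The bound on [tnorm] over [K] is part of the notion because the estimate for products needs
    it. *)
Definition approx N g := [/\ forall z, K z -> smooth g z,
  exists M, forall z, K z -> tnorm N g z <= M &
  forall e : R, 0 < e -> exists p q, polepair p q /\
    forall z, K z -> tnorm N (fun t => g t - ratf p q t) z <= e].

Lemma approx_near N g h : (forall z, K z -> \forall t \near z, g t = h t) ->
  approx N g -> approx N h.
Proof.
move=> gh [sg [M hM] ag]; split.
- by move=> z Kz; apply: smooth_near (gh z Kz) (sg z Kz).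
- by exists M => z Kz; rewrite -(tnorm_near _ (sg z Kz) (gh z Kz)) hM.
- move=> e /ag[p [q [pq hpq]]]; exists p, q; split => // z Kz.
  rewrite -(tnorm_near _ (f := fun t => g t - ratf p q t)); first exact: hpq.
    by apply: smoothB; [exact: sg|exact/smooth_ratf/(polepair_nonroot pq)].
  by apply: filterS (gh z Kz) => t ->.
Qed.

Lemma approx_ratf N p q : polepair p q ->
  (exists M, forall z, K z -> tnorm N (ratf p q) z <= M) -> approx N (ratf p q).
Proof.
move=> pq hM; split => //.
  by move=> z Kz; exact/smooth_ratf/(polepair_nonroot pq).
move=> e e0; exists p, q; split => // z Kz.
rewrite (_ : (fun t => _) = fun=> 0); first by rewrite tnorm_cst nc0 ltW.
by apply/funext => t; rewrite subrr.
Qed.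

Lemma approx_cst N c : approx N (fun=> c).
Proof.
have e : ratf c%:P 1 = fun=> c by apply/funext => t; rewrite /ratf !hornerC divr1.
rewrite -e; apply: approx_ratf; last by exists (nc c) => z _; rewrite e tnorm_cst.
split; first exact: oner_neq0.
  by move=> a ra; have := root1 a; rewrite ra.
by rewrite size_poly1 size_polyC; case: (_ != _).
Qed.

Lemma approxD N g h : approx N g -> approx N h -> approx N (fun t => g t + h t).
Proof.
move=> [sg [M hM] ag] [sh [M' hM'] ah]; split.
- by move=> z Kz; apply: smoothD; [exact: sg|exact: sh].
- exists (M + M') => z Kz; apply: le_trans (tnormD _ (sg z Kz) (sh z Kz)) _.
  by rewrite lerD ?hM ?hM'.
- move=> e e0; have e2 : 0 < e / 2 by rewrite divr_gt0.
  have [p1 [q1 [pq1 h1]]] := ag _ e2; have [p2 [q2 [pq2 h2]]] := ah _ e2.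
  exists (p1 * q2 + p2 * q1), (q1 * q2); split; first exact: polepairD.
  move=> z Kz.
  have n1 := polepair_nonroot pq1 Kz; have n2 := polepair_nonroot pq2 Kz.
  have s1 := smoothB (sg z Kz) (smooth_ratf p1 n1).
  have s2 := smoothB (sh z Kz) (smooth_ratf p2 n2).
  rewrite -(tnorm_near N (smoothD s1 s2)).
    apply: le_trans (tnormD _ s1 s2) _.
    by have := h1 z Kz; have := h2 z Kz; lra.
  apply: filterS2 (near_nonroot n1) (near_nonroot n2) => t m1 m2.
  by rewrite /ratf !(hornerD, hornerM); field; rewrite m1 m2.
Qed.

Lemma approxM N g h : approx N g -> approx N h -> approx N (fun t => g t * h t).
Proof.
move=> [sg [M hM] ag] [sh [M' hM'] ah]; split.
- by move=> z Kz; apply: smoothM; [exact: sg|exact: sh].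
- exists (M * M') => z Kz; apply: le_trans (tnormM _ (sg z Kz) (sh z Kz)) _.
  by rewrite ler_pM ?tnorm_ge0 ?hM ?hM'.
(* [B] bounds the norm of [g] and, as [d <= 1], that of the approximant of [h]. Absolute values are
   taken because [M] may be negative when [K] is empty. *)
- move=> e e0; pose B := `|M| + `|M'| + 1.
  have B0 : 0 < B by rewrite ltr_wpDl // addr_ge0.
  pose d := Num.min 1 (e / (2 * B)).
  have d0 : 0 < d by rewrite lt_min ltr01 divr_gt0 // mulr_gt0.
  have d1 : d <= 1 by rewrite ge_min lexx.
  have dB : 2 * B * d <= e.
    have : d <= e / (2 * B) by rewrite ge_min lexx orbT.
    by rewrite ler_pdivlMr ?mulr_gt0 // mulrC.
  have [p1 [q1 [pq1 h1]]] := ag _ d0; have [p2 [q2 [pq2 h2]]] := ah _ d0.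
  exists (p1 * p2), (q1 * q2); split; first exact: polepairM.
  move=> z Kz.
  have n1 := polepair_nonroot pq1 Kz; have n2 := polepair_nonroot pq2 Kz.
  have r1 := smooth_ratf p1 n1; have r2 := smooth_ratf p2 n2.
  have s1 := smoothB (sg z Kz) r1.
  have s2 := smoothB (sh z Kz) r2.
  rewrite (_ : (fun t => _) = fun t => g t * (h t - ratf p2 q2 t) + (g t - ratf p1 q1 t) * ratf p2 q2 t); last first.
    by apply/funext => t; rewrite /ratf !hornerM invfM; ring.
  apply: le_trans (tnormD _ (smoothM (sg z Kz) s2) (smoothM s1 r2)) _.
  have l1 := tnormM N (sg z Kz) s2; have l2 := tnormM N s1 r2.
  have gM : tnorm N g z <= B.
    by have := hM z Kz; have := ler_norm M; have := normr_ge0 M'; rewrite /B; lra.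
  have rM : tnorm N (ratf p2 q2) z <= B.
    have : tnorm N (fun t => h t - (h t - ratf p2 q2 t)) z <= tnorm N h z + d.
      by apply: le_trans (tnormB _ (sh z Kz) s2) _; rewrite lerD2l h2.
    rewrite (_ : (fun t => _) = ratf p2 q2); last by apply/funext => t; rewrite opprB addrC subrK.
    by have := hM' z Kz; have := ler_norm M'; have := normr_ge0 M; rewrite /B; lra.
  have k1 : tnorm N g z * tnorm N (fun t => h t - ratf p2 q2 t) z <= B * d.
    by rewrite ler_pM ?tnorm_ge0 ?h2.
  have k2 : tnorm N (fun t => g t - ratf p1 q1 t) z * tnorm N (ratf p2 q2) z <= d * B.
    by rewrite ler_pM ?tnorm_ge0 ?h1.
  lra.
Qed.

Lemma approxZ N c g : approx N g -> approx N (fun t => c * g t).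
Proof. by move=> h; apply: approxM => //; exact: approx_cst. Qed.

Lemma approxB N g h : approx N g -> approx N h -> approx N (fun t => g t - h t).
Proof.
move=> hg /(approxZ (-1)) hh; apply: approx_near (approxD hg hh) => z _.
by apply: near_allC => t; rewrite mulN1r.
Qed.

Lemma approx_lim N g : (forall z, K z -> smooth g z) ->
  (forall e : R, 0 < e -> exists2 h, approx N h &
    forall z, K z -> tnorm N (fun t => g t - h t) z <= e) -> approx N g.
Proof.
move=> sg hg; split => //.
  have [h [sh [M hM] _] gh] := hg 1 ltr01; exists (M + 1) => z Kz.
  rewrite (_ : g = fun t => h t + (g t - h t)); last by apply/funext => t; rewrite addrC subrK.
  apply: le_trans (tnormD _ (sh z Kz) (smoothB (sg z Kz) (sh z Kz))) _.
  by rewrite lerD ?hM ?gh.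
move=> e e0; have e2 : 0 < e / 2 by rewrite divr_gt0.
have [h [sh _ ah] gh] := hg _ e2; have [p [q [pq hpq]]] := ah _ e2.
exists p, q; split => // z Kz.
have n := polepair_nonroot pq Kz.
rewrite (_ : (fun t => _) = fun t => (g t - h t) + (h t - ratf p q t)); last first.
  by apply/funext => t; rewrite subrKA.
have s1 := smoothB (sg z Kz) (sh z Kz); have s2 := smoothB (sh z Kz) (smooth_ratf p n).
apply: le_trans (tnormD _ s1 s2) _.
by have := gh z Kz; have := hpq z Kz; lra.
Qed.

(** The norm [T] of [y] satisfies [T <= 1 + T / 2]. *)
Lemma tnorm_geom N x y z : smooth x z -> smooth y z ->
  (\forall t \near z, y t = 1 + x t * y t) -> tnorm N x z <= 2^-1 -> tnorm N y z <= 2.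
Proof.
move=> sx sy hy x2; have e := tnorm_near N sy hy.
have l1 := tnormM N sx sy; have := tnormD N (smooth_cst 1 z) (smoothM sx sy).
rewrite tnorm_cst nc1 => l2.
have l3 : tnorm N x z * tnorm N y z <= 2^-1 * tnorm N y z by rewrite ler_wpM2r ?tnorm_ge0.
lra.
Qed.

Lemma near_neq (w z : C) : w - z != 0 -> \forall t \near z, w - t != 0.
Proof.
rewrite -nc_gt0 => h; apply/nbhsCP; exists (nc (w - z)) => // t.
by apply: contraTneq => /eqP; rewrite subr_eq0 => /eqP ->; rewrite ltxx.
Qed.

(* [y = 1 / (1 - x)] is the sum of a geometric series. *)
Lemma approx_geom N x y : approx N x -> (forall z, K z -> tnorm N x z <= 2^-1) ->
  (forall z, K z -> smooth y z) ->
  (forall z, K z -> \forall t \near z, y t = 1 + x t * y t) ->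
  approx N y.
Proof.
move=> ax x2 sy hy; have [sx _ _] := ax.
apply: approx_lim => // e e0.
(* Partial sums in Horner form, so that [y - S m.+1 = x * (y - S m)] and each step halves the
   error. *)
pose S := fix S (m : nat) : C -> C := if m is m'.+1 then (fun t => 1 + x t * S m' t) else (fun=> 0).
have aS m : approx N (S m).
  elim: m => [|m IH]; first exact: approx_cst.
  by apply: approxD; [exact: approx_cst|exact: approxM].
have err m z : K z -> tnorm N (fun t => y t - S m t) z <= 2 * 2^-1 ^+ m.
  move=> Kz; elim: m => [|m IH].
    rewrite expr0 mulr1 (_ : (fun t => _) = y).
      exact: (tnorm_geom (sx z Kz) (sy z Kz) (hy z Kz) (x2 z Kz)).
    by apply/funext => t; rewrite /= subr0.
  have [sS _ _] := aS m; have [sS1 _ _] := aS m.+1.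
  have s1 := smoothB (sy z Kz) (sS z Kz).
  rewrite (tnorm_near N (smoothB (sy z Kz) (sS1 z Kz)) (g := fun t => x t * (y t - S m t))).
    apply: le_trans (tnormM _ (sx z Kz) s1) _.
    rewrite exprS mulrCA ler_pM ?tnorm_ge0 ?x2 //.
  by apply: filterS (hy z Kz) => t ht; rewrite {1}ht /=; ring.
have [m hm] := half_small (d := e / 2) ltac:(by rewrite divr_gt0).
by exists (S m) => // z Kz; apply: le_trans (err m z Kz) _; lra.
Qed.

(** * Moving the pole *)

Lemma compl_dist w : ~ K w -> exists2 d : R, 0 < d & forall z, K z -> d <= nc (w - z).
Proof.
move=> Kw; have cl : closed K by apply: compact_closed => //; exact: norm_hausdorff.
have /nbhsCP[d d0 hd] : nbhs w (~` K) by apply: open_nbhs_nbhs; split => //; exact: closed_openC.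
by exists d => // z Kz; rewrite leNgt; apply/negP; rewrite ncBC => /hd.
Qed.

Lemma approx_kern_pole N w : L (Some w) -> approx N (kern w).
Proof.
move=> Lw; have Kw := pole_notin Lw; have [d d0 hd] := compl_dist Kw.
have e : ratf (-1)%:P ('X - w%:P) = kern w.
  by apply/funext => t; rewrite /ratf hornerC hornerXsubC /kern mulN1r -invrN opprB.
rewrite -e; apply: approx_ratf; last first.
  by exists (\sum_(k < N.+1) d^-1 ^+ k.+1) => z Kz; rewrite e; apply: tnorm_kern => //; exact: hd.
split; first by rewrite polyXsubC_eq0.
  by move=> a; rewrite root_XsubC => /eqP ->.
by rewrite size_XsubC size_polyC; case: (_ != _).
Qed.

Lemma approx_id_pole N : L None -> approx N id.
Proof.
move=> LN; have [M M0 hM] := compact_boundedC cK.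
have e : ratf 'X 1 = id by apply/funext => t; rewrite /ratf hornerX hornerC divr1.
rewrite -e; apply: approx_ratf; last first.
  by exists (M + 1) => z Kz; rewrite e; apply: le_trans (tnorm_id _ _) _; rewrite lerD2r hM.
by split=> [||_] //; [exact: oner_neq0|move=> a ra; have := root1 a; rewrite ra].
Qed.

(** [kern w' = kern w * y] with [y = 1 / (1 - x)] and [x = (w - w') * kern w]; the smallness
    hypothesis says that [x] has norm at most 1/2. *)
Lemma approx_kern_move N w w' (d : R) : 0 < d -> (forall z, K z -> d <= nc (w - z)) -> ~ K w' ->
  nc (w - w') * (\sum_(k < N.+1) d^-1 ^+ k.+1) <= 2^-1 ->
  approx N (kern w) -> approx N (kern w').
Proof.
move=> d0 hd Kw' ww' ak.
have nw z : K z -> w - z != 0 by move=> /hd; exact: nc_neq0.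
have nw' z : K z -> w' - z != 0 by move=> Kz; rewrite subr_eq0; apply: contra_not_neq Kw' => ->.
have sk z : K z -> smooth (kern w) z by move=> /nw h; apply: smooth_kern; rewrite -subr_eq0.
have sk' z : K z -> smooth (kern w') z by move=> /nw' h; apply: smooth_kern; rewrite -subr_eq0.
pose x t := (w - w') * kern w t; pose y t := (w - t) * kern w' t.
have ax : approx N x by exact: approxZ.
have x2 z : K z -> tnorm N x z <= 2^-1.
  move=> Kz; apply: le_trans (tnormZ _ _ (sk z Kz)) _; apply: le_trans ww'.
  by rewrite ler_wpM2l ?nc_ge0 //; apply: tnorm_kern => //; exact: hd.
have sy z : K z -> smooth y z.
  move=> Kz; apply: smoothM; last exact: sk'.
  by apply: smoothB; [exact: smooth_cst|exact: smooth_id].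
have hy z : K z -> \forall t \near z, y t = 1 + x t * y t.
  move=> Kz; apply: filterS2 (near_neq (nw z Kz)) (near_neq (nw' z Kz)) => t n1 n2.
  by rewrite /y /x /kern; field; rewrite n1 n2.
have ay := approx_geom ax x2 sy hy.
apply: approx_near (approxM ak ay) => z Kz.
apply: filterS (near_neq (nw z Kz)) => t n1.
by rewrite /y /kern mulrA mulVf // mul1r.
Qed.

(** With [x = t / w], the function [y = w * kern w] is [1 / (1 - x)], a geometric series in [t].
    Conversely [1 - x = 1 / (1 - (1 - y))], where [1 - y = - x * y] has norm at most [4^-1 * 2]:
    hence the factor 4 in the radius. *)
Lemma approx_infty N : exists2 B : R, 0 < B & forall w, B < nc w ->
  ~ K w /\ (approx N (kern w) <-> approx N id).
Proof.
have [M M0 hM] := compact_boundedC cK.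
exists (4 * (M + 1)); first lra.
move=> w wB; have w0 : 0 < nc w by lra.
have wn : w != 0 by rewrite -nc_gt0.
have Kw : ~ K w by move=> /hM; lra.
have nw z : K z -> w - z != 0 by move=> Kz; rewrite subr_eq0; apply: contra_not_neq Kw => ->.
have sk z : K z -> smooth (kern w) z by move=> /nw h; apply: smooth_kern; rewrite -subr_eq0.
pose x t := w^-1 * t; pose y t := w * kern w t.
have sx z : smooth x z by apply: smoothM; [exact: smooth_cst|exact: smooth_id].
have sy z : K z -> smooth y z by move=> Kz; apply: smoothM; [exact: smooth_cst|exact: sk].
have x4 z : K z -> tnorm N x z <= 4^-1.
  move=> Kz; apply: le_trans (tnormZ _ _ (smooth_id z)) _.
  rewrite ncV mulrC ler_pdivrMr //; have := tnorm_id N z; have := hM z Kz; lra.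
have hy z : K z -> \forall t \near z, y t = 1 + x t * y t.
  by move=> /nw/near_neq; apply: filterS => t n; rewrite /y /x /kern; field; rewrite n wn.
have x2 z : K z -> tnorm N x z <= 2^-1 by move=> /x4; lra.
split => //; split=> [ak|ai].
  have ay : approx N y by exact: approxZ.
  have y2 z : K z -> tnorm N y z <= 2.
    by move=> Kz; exact: (tnorm_geom (sx z) (sy z Kz) (hy z Kz) (x2 z Kz)).
  pose x' t := 1 - y t; pose y' t := 1 - x t.
  have ax' : approx N x' by apply: approxB => //; exact: approx_cst.
  have sy' z : K z -> smooth y' z by move=> Kz; apply: smoothB => //; exact: smooth_cst.
  have x'2 z : K z -> tnorm N x' z <= 2^-1.
    move=> Kz; have sxy := smoothM (sx z) (sy z Kz).
    have sx' : smooth x' z by apply: smoothB; [exact: smooth_cst|exact: sy].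
    rewrite (tnorm_near N sx' (g := fun t => - (x t * y t))); last first.
      by apply: filterS (hy z Kz) => t ht; rewrite /x' {1}ht; ring.
    apply: le_trans (tnormN _ sxy) _; apply: le_trans (tnormM _ (sx z) (sy z Kz)) _.
    have := ler_pM (tnorm_ge0 N x z) (tnorm_ge0 N y z) (x4 z Kz) (y2 z Kz); lra.
  have hy' z : K z -> \forall t \near z, y' t = 1 + x' t * y' t.
    by move=> /nw/near_neq; apply: filterS => t n; rewrite /y' /x' /x /y /kern; field; rewrite n wn.
  have ay' := approx_geom ax' x'2 sy' hy'.
  apply: approx_near (approxZ w (approxB (approx_cst N 1) ay')) => z Kz.
  by apply: near_allC => t; rewrite /y' /x; field.
have ax : approx N x by exact: approxZ.
have ay := approx_geom ax x2 (fun z Kz => sy z Kz) hy.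
apply: approx_near (approxZ w^-1 ay) => z Kz.
by apply: near_allC => t; rewrite /y mulrA mulVf // mul1r.
Qed.

(** * Riemann sums of Cauchy integrals *)

Lemma tjetZ c f z a : tjet f z a -> tjet (fun t => c * f t) z (fun k t => c * a k t).
Proof.
move=> [f0 da]; split; first by apply: filterS f0 => t ->.
move=> k; apply: filterS (da k) => t d.
by rewrite mulrCA; exact: (is_deriveZ c d).
Qed.

Lemma tjet_dsum (phi gam : R -> C) z n : (forall t, 0 <= t <= 1 -> gam t != z) ->
  tjet (fun u => dsum (fun t => phi t * kern (gam t) u) n) z
    (fun k u => dsum (fun t => phi t * kern (gam t) u ^+ k.+1) n).
Proof.
elim: n phi gam => [|n IH] phi gam hz /=.
  by apply/tjetZ/tjet_kern/hz; rewrite lexx ler01.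
have h1 := IH (fun t => phi (t / 2)) (fun t => gam (t / 2)) (fun t t01 => hz _ (half_in01 t01).1).
have h2 := IH (fun t => phi ((1 + t) / 2)) (fun t => gam ((1 + t) / 2)) (fun t t01 => hz _ (half_in01 t01).2).
have := tjetZ 2^-1 (tjetD h1 h2).
by congr tjet; [apply/funext => u|apply/funext => k; apply/funext => u]; rewrite mulrC.
Qed.

Lemma approx_dsum N (phi gam : R -> C) n : (forall t, 0 <= t <= 1 -> approx N (kern (gam t))) ->
  approx N (fun u => dsum (fun t => phi t * kern (gam t) u) n).
Proof.
elim: n phi gam => [|n IH] phi gam hz /=.
  by apply/approxZ/hz; rewrite lexx ler01.
have h1 := IH (fun t => phi (t / 2)) (fun t => gam (t / 2)) (fun t t01 => hz _ (half_in01 t01).1).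
have h2 := IH (fun t => phi ((1 + t) / 2)) (fun t => gam ((1 + t) / 2)) (fun t t01 => hz _ (half_in01 t01).2).
have := approxZ 2^-1 (approxD h1 h2).
by congr (approx N _); apply/funext => u; rewrite mulrC.
Qed.

(** The modulus [d] does not depend on [z], so one subdivision serves for all of [K]. *)
Definition equicont (psi : C -> R -> C) :=
  (exists2 B : R, 0 < B & forall z t, K z -> 0 <= t <= 1 -> nc (psi z t) <= B) /\
  forall e : R, 0 < e -> exists2 d : R, 0 < d & forall z s t, K z -> 0 <= s <= 1 -> 0 <= t <= 1 ->
    `|s - t| <= d -> nc (psi z s - psi z t) <= e.

Lemma equicontM psi1 psi2 : equicont psi1 -> equicont psi2 ->
  equicont (fun z t => psi1 z t * psi2 z t).
Proof.
move=> [[B1 B10 h1] u1] [[B2 B20 h2] u2]; split.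
  exists (B1 * B2); first exact: mulr_gt0.
  by move=> z t Kz t01; rewrite ncM ler_pM ?nc_ge0 ?h1 ?h2.
move=> e e0.
have [d1 d10 k1] := u1 (e / (2 * B2)) ltac:(by rewrite divr_gt0 ?mulr_gt0).
have [d2 d20 k2] := u2 (e / (2 * B1)) ltac:(by rewrite divr_gt0 ?mulr_gt0).
exists (Num.min d1 d2); first by rewrite lt_min d10.
move=> z s t Kz s01 t01; rewrite le_min => /andP[st1 st2].
have -> : psi1 z s * psi2 z s - psi1 z t * psi2 z t =
  (psi1 z s - psi1 z t) * psi2 z s + psi1 z t * (psi2 z s - psi2 z t) by ring.
apply: le_trans (ncD _ _) _; rewrite !ncM.
have l1 : nc (psi1 z s - psi1 z t) * nc (psi2 z s) <= e / (2 * B2) * B2.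
  by rewrite ler_pM ?nc_ge0 ?k1 ?h2.
have l2 : nc (psi1 z t) * nc (psi2 z s - psi2 z t) <= B1 * (e / (2 * B1)).
  by rewrite ler_pM ?nc_ge0 ?k2 ?h1.
have e1 : e / (2 * B2) * B2 = e / 2 by field; rewrite gt_eqF.
have e2 : B1 * (e / (2 * B1)) = e / 2 by field; rewrite gt_eqF.
lra.
Qed.

(** Each induction step multiplies by one more kernel, which as a function of the path point is
    bounded by [rho^-1] and Lipschitz with constant [rho^-2]. *)
Lemma equicont_edge phi gam (rho : R) k : 0 < rho -> cont01 phi -> cont01 gam ->
  (forall t z, 0 <= t <= 1 -> K z -> rho <= nc (gam t - z)) ->
  equicont (fun z t => phi t * kern (gam t) z ^+ k).
Proof.
move=> r0 cp cg hm; elim: k => [|k IH].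
  split.
    have [B B0 hB] := cont01_bounded cp; exists B => // z t _ t01.
    by rewrite expr0 mulr1 hB.
  move=> e e0; have [d d0 hd] := cont01_unif cp e0; exists d => // z s t _ s01 t01 st.
  by rewrite !expr0 !mulr1 hd.
rewrite (_ : (fun z t => _) = fun z t => phi t * kern (gam t) z ^+ k * kern (gam t) z); last first.
  by apply/funext => z; apply/funext => t; rewrite exprSr mulrA.
apply: equicontM => //; split.
  exists rho^-1; first by rewrite invr_gt0.
  by move=> z t Kz t01; apply: (nc_inv_le r0); exact: hm.
move=> e e0; have er : 0 < e * rho ^+ 2 by rewrite mulr_gt0 ?exprn_gt0.
have [d d0 hd] := cont01_unif cg er; exists d => // z s t Kz s01 t01 st.
have hs := hm s z s01 Kz; have ht := hm t z t01 Kz.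
rewrite /kern inv_sub ?(nc_neq0 r0 hs) ?(nc_neq0 r0 ht) // !ncM.
have -> : gam t - z - (gam s - z) = gam t - gam s by ring.
have h1 := hd t s t01 s01 ltac:(by rewrite distrC).
have -> : e = e * rho ^+ 2 * rho^-1 * rho^-1 by field; rewrite gt_eqF.
by rewrite ler_pM ?mulr_ge0 ?nc_ge0 ?(nc_inv_le r0 ht) // ler_pM ?nc_ge0 ?(nc_inv_le r0 hs).
Qed.

(** The [k]-th coefficient of the Riemann sum is the Riemann sum of the [k]-th coefficient, so a
    single subdivision makes all [N + 1] coefficients accurate to [e / (N + 1)]. *)
Lemma approx_edgeK N phi gam (rho : R) : 0 < rho -> cont01 phi -> cont01 gam ->
  (forall t z, 0 <= t <= 1 -> K z -> rho <= nc (gam t - z)) ->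
  (forall t, 0 <= t <= 1 -> approx N (kern (gam t))) -> approx N (edgeK phi gam 0).
Proof.
move=> r0 cp cg hm ak; apply: approx_lim.
  by move=> z Kz; eexists; apply: (tjet_edgeK r0 cp cg) => t t01; exact: hm.
move=> e e0; pose e' := e / N.+1%:R.
have e'0 : 0 < e' by rewrite divr_gt0.
have [d d0 hd] : exists2 d : R, 0 < d & forall k, (k <= N)%N -> forall z s t, K z ->
    0 <= s <= 1 -> 0 <= t <= 1 -> `|s - t| <= d ->
    nc (phi s * kern (gam s) z ^+ k.+1 - phi t * kern (gam t) z ^+ k.+1) <= e'.
  elim: {1}N => [|M [d d0 hd]].
    have [d d0 hd] := (equicont_edge 1 r0 cp cg hm).2 _ e'0.
    by exists d => // k; rewrite leqn0 => /eqP ->.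
  have [d' d'0 hd'] := (equicont_edge M.+2 r0 cp cg hm).2 _ e'0.
  exists (Num.min d d'); first by rewrite lt_min d0.
  move=> k kM z s t Kz s01 t01; rewrite le_min => /andP[st1 st2].
  move: kM; rewrite leq_eqVlt => /orP[/eqP -> |kM]; first exact: hd'.
  exact: hd.
have [n hn] := half_small d0.
exists (fun u => dsum (fun t => phi t * kern (gam t) u) n); first exact: approx_dsum.
move=> z Kz.
have j1 := tjet_edgeK r0 cp cg (fun t t01 => hm t z t01 Kz).
have gz t : 0 <= t <= 1 -> gam t != z.
  by move=> t01; rewrite -subr_eq0; exact: nc_neq0 r0 (hm t z t01 Kz).
have j2 := tjet_dsum phi n gz.
have j3 := tjetD j1 (tjetZ (-1) j2).
rewrite (_ : (fun t => _) = fun t => edgeK phi gam 0 t + -1 * dsum (fun u => phi u * kern (gam u) t) n); last first.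
  by apply/funext => t; rewrite mulN1r.
rewrite (tnorm_jet _ j3).
apply: le_trans (_ : \sum_(k < N.+1) e' <= e); last first.
  by rewrite sumr_const card_ord -mulr_natr /e' divfK // pnatr_eq0.
apply: ler_sum => k _; rewrite mulN1r; apply: int01_dsum.
  exact: (cont01_edgeK k.+1 r0 cp cg (fun t t01 => hm t z t01 Kz)).
move=> s t s01 t01 st; apply: hd => //; first by rewrite -ltnS.
exact: le_trans st hn.
Qed.

(* The simple pole at infinity is that of the identity. *)
Definition approx_at N (P : sphere R) : Prop :=
  if P is Some w then approx N (kern w) else approx N id.

(** Near a finite [w], one distance [d] to [K] is valid for [w] and for all nearby [v], so the pole
    can be moved both ways; at infinity [approx_infty] takes this role. *)
Lemma approx_at_near N (P : sphere R) : sphere_compl K P ->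
  nbhs P [set Q | sphere_compl K Q /\ (approx_at N Q <-> approx_at N P)].
Proof.
case: P => [w|] hw.
  have Kw : ~ K w by move=> kw; apply: hw; exists w.
  have [d0 d00 hd0] := compl_dist Kw.
  pose d := d0 / 2; have dp : 0 < d by rewrite divr_gt0.
  pose S := \sum_(k < N.+1) d^-1 ^+ k.+1.
  have S0 : 0 <= S by apply: sumr_ge0 => k _; rewrite exprn_ge0 // invr_ge0 ltW.
  have S1 : 0 < 2 * (S + 1) by lra.
  suff : nbhs w [set v | sphere_compl K (Some v : sphere R) /\ (approx N (kern v) <-> approx N (kern w))] by [].
  apply/nbhsCP; exists (Num.min d (2 * (S + 1))^-1); first by rewrite lt_min dp invr_gt0.
  move=> v; rewrite lt_min => /andP[vd vS].
  have hv z : K z -> d <= nc (v - z).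
    move=> /hd0 h; have := ncD (w - v) (v - z); rewrite subrKA ncBC /d in vd * => l.
    by rewrite ncBC in vd; move: vd l h; rewrite /d (ncBC w v); lra.
  have hw' z : K z -> d <= nc (w - z) by move=> /hd0; rewrite /d; lra.
  have Kv : ~ K v by move=> /hv; rewrite subrr nc0 leNgt dp.
  have small : nc (v - w) * S <= 2^-1.
    apply: le_trans (_ : (2 * (S + 1))^-1 * S <= _).
      by rewrite ler_wpM2r // ltW.
    rewrite mulrC ler_pdivrMr //; lra.
  split; first by move=> [z Kz [zv]]; apply: Kv; rewrite -zv.
  split; first exact: (approx_kern_move dp hv Kw small).
  by rewrite ncBC in small; exact: (approx_kern_move dp hw' Kv small).
have [B B0 hB] := approx_infty N.
(* The complement of a closed compact set is a neighbourhood of infinity; this one contains the disc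
   of radius [B]. *)
pose box := (fun p : R * R => Complex p.1 p.2) @` (`[- B, B] `*` `[- B, B])%classic.
have cbox : compact box.
  apply: continuous_compact; last by apply: compact_setX; exact: segment_compact.
  apply: continuous_subspaceT => -[x y].
  apply/(cvgCP (nbhs_filter (x, y))) => e e0.
  have e2 : 0 < e / 2 by rewrite divr_gt0.
  exists (ball x (e / 2), ball y (e / 2)) => /=; first by split; exact: nbhsx_ballx.
  move=> [x' y'] [hx hy]; apply: (le_lt_trans (nc_le_ReIm (Complex (x' - x) (y' - y)))).
  by move: hx hy; rewrite /ball /= distrC (distrC y); lra.
exists box; first by split => //; apply: compact_closed => //; exact: norm_hausdorff.
have out v : ~ box v -> B < nc v.
  move=> nb; rewrite ltNge; apply/negP => vB; apply: nb.
  exists (cRe v, cIm v); last by case: (v).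
  by split; rewrite /= in_itv /= -ler_norml (le_trans _ vB) // ?Re_le_nc ?Im_le_nc.
move=> _ [[v /out /hB[Kv e] <-]|->]; last by [].
by split; first by move=> [z Kz [zv]]; apply: Kv; rewrite -zv.
Qed.

Hypothesis hcomp : forall P : sphere R, sphere_compl K P ->
  connected_component (sphere_compl K) P `&` L !=set0.

Lemma approx_kern N w : ~ K w -> approx N (kern w).
Proof.
move=> Kw; have cw : sphere_compl K (Some w : sphere R).
  by move=> [z Kz [zw]]; apply: Kw; rewrite -zw.
pose A := connected_component (sphere_compl K) (Some w : sphere R).
have AK : A `<=` sphere_compl K by exact: connected_component_sub.
(* As [approx_at_near] gives an equivalence, the approximable points and the other ones both form
   open sets. *)
have op (b : bool) : open [set Q | sphere_compl K Q /\ if b then approx_at N Q else ~ approx_at N Q].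
  rewrite openE => Q [cQ aQ]; rewrite /interior.
  apply: filterS (approx_at_near N cQ) => Q' [cQ' e]; split => //.
  by case: b aQ => [/e|h /e].
have cA : connected A by exact: component_connected.
have e : A `&` [set Q | approx_at N Q] = A.
  apply: cA.
  - have [l [Al Ll]] := hcomp cw; exists l; split => //=.
    case: l Ll {Al} => [v|] Ll; [exact: approx_kern_pole|exact: approx_id_pole].
  - exists [set Q | sphere_compl K Q /\ approx_at N Q]; first exact: (op true).
    by apply/seteqP; split=> [Q [AQ aQ]|Q [AQ [_ aQ]]]; split => //; split => //; exact: AK.
  - exists (~` [set Q | sphere_compl K Q /\ ~ approx_at N Q]).
      by apply: open_closedC; exact: (op false).
    apply/seteqP; split=> [Q [AQ aQ]|Q [AQ nQ]]; split => //.
      by move=> [_].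
    by apply: contrapT => naQ; apply: nQ; split => //; exact: AK.
suff : (A `&` [set Q | approx_at N Q]) (Some w) by case.
by rewrite e; exact: connected_component_refl.
Qed.

Lemma approx_space_O N f : space_O K f -> approx N f.
Proof.
move=> [V [oV KV fV]].
have [E [rho [r0 hE fE]]] := cauchy_edges cK oV KV fV.
suff aE : approx N (fun z => \sum_(e <- E) e.1.1 / cpi * edgeK (f \o epath e) (epath e) 0 z).
  apply: approx_near aE => k Kk; apply/nbhsCP; exists rho => // z zk.
  by rewrite -(fE k z Kk zk).
elim: E hE {fE} => [|e E IH] hE.
  rewrite (_ : (fun z => _) = fun=> 0); first exact: approx_cst.
  by apply/funext => z; rewrite big_nil.
rewrite (_ : (fun z => _) = fun z => e.1.1 / cpi * edgeK (f \o epath e) (epath e) 0 z +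
    \sum_(e <- E) e.1.1 / cpi * edgeK (f \o epath e) (epath e) 0 z); last first.
  by apply/funext => z; rewrite big_cons.
have he t : 0 <= t <= 1 -> V (epath e t) /\ forall k, K k -> rho <= nc (epath e t - k).
  by apply: hE; rewrite mem_head.
apply: approxD; last by apply: IH => e' t e'E; apply: hE; rewrite inE e'E orbT.
apply/approxZ/(approx_edgeK r0) => [||t z t01 Kz|t t01].
- apply: (cont01_comp (f := f)); first exact: cont01_epath.
  by move=> t t01; apply/derivable_contC/fV; have [] := he t t01.
- exact: cont01_epath.
- exact: (he t t01).2.
- apply: approx_kern => Ke; have := (he t t01).2 _ Ke.
  by rewrite subrr nc0 leNgt r0.
Qed.

End Algebra.

End Approximation.

(** * Density *)

Section Density.
Context {R : realType}.
Local Notation C := R[i].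
Implicit Types (f g : C -> C) (z w : C) (p q : {poly C}) (K : set C).

Lemma tnorm_derive1n N f g z k (e : R) : (k <= N)%N -> smooth f z -> smooth g z ->
  tnorm N (fun t => f t - g t) z <= e ->
  nc (derive1n k f z - derive1n k g z) <= k`!%:R * e.
Proof.
move=> kN [a ha] [b hb] h.
have hab := tjetD ha (tjetZ (-1) hb).
have -> : derive1n k f z - derive1n k g z = k`!%:R * (a k z + -1 * b k z).
  rewrite (nbhs_singleton (tjet_derive1n k ha)) (nbhs_singleton (tjet_derive1n k hb)).
  by ring.
rewrite ncM nc_nat ler_wpM2l //; apply: le_trans h.
rewrite (_ : (fun t => _) = fun t => f t + -1 * g t); last by apply/funext => t; rewrite mulN1r.
rewrite (tnorm_jet _ hab) (bigD1 (Ordinal (kN : (k < N.+1)%N))) //= lerDl.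
by apply: sumr_ge0 => i _; exact: nc_ge0.
Qed.

Lemma leq_fact k N : (k <= N)%N -> (k`! <= N`!)%N.
Proof.
move=> /subnKC <-; elim: (N - k)%N => [|m IH]; first by rewrite addn0.
by rewrite addnS factS (leq_trans IH) // leq_pmull.
Qed.

(** * Supremum norms and the metric *)

Lemma supnorm_ge0 K f : 0 <= supnorm K f.
Proof.
rewrite /supnorm; have [[h1 h2]|h] := pselect (has_sup [set nc (f z) | z in K]).
  have [y Sy] := h1; have [z _ yz] := Sy.
  by apply: le_trans (sup_ubound h2 Sy); rewrite -yz nc_ge0.
by rewrite sup_out.
Qed.

Lemma supnorm_le K f (M : R) : 0 <= M -> (forall z, K z -> nc (f z) <= M) -> supnorm K f <= M.
Proof.
move=> M0 h; rewrite /supnorm.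
have [e|/set0P ne] := eqVneq [set nc (f z) | z in K] set0; first by rewrite e sup0.
by apply: ge_sup => // _ [z Kz <-]; exact: h.
Qed.

Lemma le_supnorm K f (M : R) z : (forall z, K z -> nc (f z) <= M) -> K z -> nc (f z) <= supnorm K f.
Proof.
move=> h Kz; apply: sup_ubound; last by exists z.
by exists M => _ [w Kw <-]; exact: h.
Qed.

(** The orders up to [N] contribute at most [2 * (e / 8)]; the later terms are at most [2 ^ - k],
    with sum [2 ^ - N <= e / 4]. Together this is at most [e / 2]. *)
Lemma dist_lt K (e : R) : 0 < e -> exists N, exists2 eta : R, 0 < eta & forall g h : nat -> C -> C,
  (forall k, (k <= N)%N -> supnorm K (g k \- h k) <= eta) -> dist K g h < e.
Proof.
move=> e0; have [N hN] := half_small (d := e / 4) ltac:(by rewrite divr_gt0).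
exists N, (e / 8); first by rewrite divr_gt0.
move=> g h gh; rewrite /dist.
set u := fun k : nat => (2 ^+ k)^-1 * _.
have pow0 k : 0 < (2 ^+ k)^-1 :> R by rewrite invr_gt0 exprn_gt0.
have u0 k : 0 <= u k.
  rewrite mulr_ge0 ?(ltW (pow0 k)) // divr_ge0 ?supnorm_ge0 //.
  by have := supnorm_ge0 K (g k \- h k); lra.
have u1 k : u k <= (2 ^+ k)^-1.
  rewrite /u -[leRHS]mulr1 ler_wpM2l ?(ltW (pow0 k)) //.
  have := supnorm_ge0 K (g k \- h k) => s0.
  by rewrite ler_pdivrMr ?mul1r; lra.
have u2 k : (k <= N)%N -> u k <= (2 ^+ k)^-1 * (e / 8).
  move=> /gh hk; rewrite /u ler_wpM2l ?(ltW (pow0 k)) //.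
  have := supnorm_ge0 K (g k \- h k) => s0.
  have p0 : 0 < 1 + supnorm K (g k \- h k) by lra.
  rewrite ler_pdivrMr //; apply: le_trans hk _; rewrite ler_peMr //; lra.
have half k : (2 ^+ k)^-1 = (2 ^+ k.+1)^-1 * 2 :> R.
  by rewrite exprS invfM mulrAC mulVf ?mul1r.
have incr n m : series u n <= series u (n + m)%N.
  elim: m => [|m IH]; rewrite ?addn0 // addnS /series /= big_nat_recr //=.
  by apply: le_trans IH _; rewrite lerDl.
have S1 n : (n <= N.+1)%N -> series u n <= (2 - 2 * (2 ^+ n)^-1) * (e / 8).
  elim: n => [|n IH] nN; first by rewrite /series /= big_geq // expr0 invr1 mulr1 subrr mul0r.
  rewrite /series /= big_nat_recr //=; have := IH (ltnW nN); have := u2 n nN.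
  rewrite /series /= (half n) => l1 l2; apply: le_trans (lerD l2 l1) _.
  by rewrite -mulrDl; apply: ler_wpM2r; lra.
have S2 m : series u (N.+1 + m)%N <= 2 * (e / 8) + (2 ^+ N)^-1 - 2 * (2 ^+ (N.+1 + m))^-1.
  elim: m => [|m IH].
    rewrite addn0; apply: le_trans (S1 _ (leqnn _)) _; rewrite (half N).
    have : 0 <= (2 ^+ N.+1)^-1 * (e / 8) by rewrite mulr_ge0 // ?(ltW (pow0 _)) // divr_ge0 // ltW.
    lra.
  rewrite addnS /series /= big_nat_recr //=; have := u1 (N.+1 + m)%N.
  rewrite /series /= in IH *; rewrite (half (N.+1 + m)%N) in IH *; lra.
have bnd n : series u n <= e / 2.
  apply: le_trans (incr n N.+1) _; rewrite addnC; apply: le_trans (S2 n) _.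
  have := pow0 (N.+1 + n)%N; rewrite exprVn in hN; lra.
apply: le_lt_trans (_ : e / 2 < e); last lra.
(* The partial sums increase and are bounded, so [limn] is a genuine limit and not a default
   value. *)
apply: limr_le; last by apply: nearW.
apply: nondecreasing_is_cvgn.
  by apply/nondecreasing_seqP => n; have := incr n 1%N; rewrite addn1.
by exists (e / 2) => _ [n _ <-].
Qed.

Lemma compact_bounded_within K f : compact K -> {within K, continuous f} ->
  exists M : R, forall z, K z -> nc (f z) <= M.
Proof.
move=> cK cf; have [M _ hM] := compact_boundedC (continuous_compact cf cK).
by exists M => z Kz; apply: hM; exists z.
Qed.

Lemma smooth_derive1n f z k : smooth f z -> derivable (derive1n k f) z 1.
Proof. by move=> [a /(tjet_derivable k)/nbhs_singleton]. Qed.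

Lemma smooth_within K f k : (forall z, K z -> smooth f z) -> {within K, continuous (derive1n k f)}.
Proof.
move=> sf; apply: continuous_in_subspaceT => z /set_mem Kz.
exact (derivable_contC (smooth_derive1n (k := k) (sf z Kz))).
Qed.

(** * Fractions in lowest terms *)

Section Rational.
Variables (K : set C) (L : set (sphere R)).
Hypotheses (cK : compact K) (hL : L `<=` sphere_compl K).

Lemma rational_polepair f : rational_with_poles_in L f ->
  exists p q, polepair L p q /\ f = ratf p q.
Proof.
move=> [p [q [q0 cpq hp ->]]]; exists p, q; split => //; split => //.
  by move=> a ra; exact: (hp (Some a)).
by move=> s; exact: (hp None).
Qed.

(** Cancelling the gcd creates no root of the denominator and lowers both degrees equally. Values
    may change at roots of [q], where division by zero gives junk. *)
Lemma polepair_rational p q : polepair L p q -> exists2 r, rational_with_poles_in L r &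
  forall z, ~~ root q z -> r z = ratf p q z.
Proof.
move=> [q0 rq sq]; pose d := gcdp p q.
have dp : p = p %/ d * d by rewrite divpK // dvdp_gcdl.
have dq : q = q %/ d * d by rewrite divpK // dvdp_gcdr.
have d0 : d != 0 by rewrite gcdp_eq0 negb_and q0 orbT.
have q'0 : q %/ d != 0 by apply: contraNneq q0 => e; rewrite dq e mul0r.
exists (fun z => (p %/ d).[z] / (q %/ d).[z]).
  exists (p %/ d), (q %/ d); split=> //.
    by apply: coprimep_div_gcd; rewrite q0 orbT.
  case=> [a|] /=.
    by move=> ra; apply: rq; rewrite dq rootM ra.
  move=> s; apply: sq; rewrite dp dq !size_mul //; last first.
    by apply: contraTneq s => ->; rewrite size_poly0.
  have q'1 : (0 < size (q %/ d)%R)%N by rewrite size_poly_gt0.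
  rewrite -!subn1 ltn_sub2r ?ltn_add2r //.
  exact: leq_trans (leq_ltn_trans q'1 s) (leq_addr _ _).
move=> z qz.
have pE : p.[z] = (p %/ d).[z] * d.[z] by rewrite -hornerM -dp.
have qE : q.[z] = (q %/ d).[z] * d.[z] by rewrite -hornerM -dq.
rewrite /ratf pE qE.
have dz : d.[z] != 0 by apply: contraNneq qz => e; rewrite rootE dq hornerM e mulr0.
have q'z : (q %/ d).[z] != 0 by apply: contraNneq qz => e; rewrite rootE dq hornerM e mul0r.
by field; rewrite dz q'z.
Qed.

Lemma smooth_rational f z : rational_with_poles_in L f -> K z -> smooth f z.
Proof.
move=> /rational_polepair[p [q [pq ->]]] Kz.
exact: (smooth_ratf p (polepair_nonroot hL pq Kz)).
Qed.

Lemma rational_space_O : rational_with_poles_in L `<=` space_O K.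
Proof.
move=> f /rational_polepair[p [q [pq ->]]].
exists [set z | ~~ root q z]; split.
- rewrite openE => z /= qz; rewrite /interior; exact: (near_nonroot qz).
- by move=> z Kz; exact: (polepair_nonroot hL pq Kz).
- move=> z qz; exact: (smooth_derive1n (k := 0%N) (smooth_ratf p qz)).
Qed.

Lemma jet_rational_space_B : jet @` rational_with_poles_in L `<=` space_B K.
Proof.
move=> _ [f rf <-]; have sf z (Kz : K z) := smooth_rational rf Kz.
split.
  move=> k; split; first exact: smooth_within.
  by move=> z /interior_subset Kz; exact: (smooth_derive1n (k := k) (sf z Kz)).
exists (fun=> f); split; first by move=> _; exact: rational_space_O.
move=> k; rewrite (_ : supnorm _ _ = 0); first exact: cvg_cst.
apply/eqP; rewrite eq_le supnorm_ge0 andbT; apply: supnorm_le => // z _.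
by rewrite /= subrr nc0.
Qed.

End Rational.

End Density.

Unset Implicit Arguments.

Theorem proposition2p6 (R : realType) (K : set R[i]) (L : set (sphere R))
  (hK : compact K)
  (hL : L `<=` sphere_compl K)
  (hcomp : forall w : sphere R, sphere_compl K w ->
     connected_component (sphere_compl K) w `&` L !=set0) :
  rational_with_poles_in L `<=` space_O K /\
  dense_in (dist K) (space_B K) (jet @` rational_with_poles_in L).
Proof.
split; first exact: rational_space_O.
split; first exact: jet_rational_space_B.
move=> g [gA [F [FO Fg]]] e e0.
have [N [eta eta0 hN]] := dist_lt K e0.
have eta2 : 0 < eta / 2 by rewrite divr_gt0.
have [n hn] : exists n, forall k, (k <= N)%N -> supnorm K (jet (F n) k \- g k) <= eta / 2.
  have near_k k : \forall n \near \oo, supnorm K (jet (F n) k \- g k) <= eta / 2.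
    have /cvgrPdist_le/(_ _ eta2) := Fg k; apply: filterS => n.
    by rewrite sub0r normrN ger0_norm // supnorm_ge0.
  have : \forall n \near \oo, forall k : 'I_N.+1, supnorm K (jet (F n) k \- g k) <= eta / 2.
    by apply: filter_forall => k; exact: near_k.
  move=> /filter_ex[n hn]; exists n => k kN.
  exact: (hn (Ordinal (kN : (k < N.+1)%N))).
have [sF _ aF] := approx_space_O hK hL hcomp N (FO n).
(* Derivatives of order [k <= N] are Taylor coefficients times a factorial, at most that of [N]. *)
pose e' := eta / (2 * N`!%:R).
have NF : 0 < N`!%:R :> R by rewrite ltr0n fact_gt0.
have e'0 : 0 < e' by rewrite divr_gt0 // mulr_gt0.
have [p [q [pq hpq]]] := aF e' e'0.
have [r rL rE] := polepair_rational pq.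
exists (jet r); first by exists r.
apply: hN => k kN; apply: supnorm_le; first exact: ltW.
move=> z Kz /=.
have qz := polepair_nonroot hL pq Kz.
have rp : \forall t \near z, ratf p q t = r t.
  by apply: filterS (near_nonroot qz) => t qt; rewrite rE.
have sr := smooth_rational hL rL Kz.
have h1 : nc (jet (F n) k z - jet r k z) <= eta / 2.
  apply: le_trans (tnorm_derive1n kN (sF z Kz) sr (e := e') _) _.
    rewrite -(tnorm_near N (smoothB (sF z Kz) (smooth_ratf p qz))); first exact: hpq.
    by apply: filterS rp => t ->.
  apply: le_trans (_ : N`!%:R * e' <= _).
    by rewrite ler_wpM2r ?(ltW e'0) // ler_nat leq_fact.
  by rewrite /e' mulrC invfM !mulrA divfK // gt_eqF.
(* The supremum of an unbounded set defaults to 0, so values lie below [supnorm] only once the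
   difference is known to be bounded; this comes from continuity on the compact [K]. *)
have h2 : nc (jet (F n) k z - g k z) <= eta / 2.
  have [M1 hM1] := compact_bounded_within hK (smooth_within (k := k) sF).
  have [M2 hM2] := compact_bounded_within hK (gA k).1.
  apply: le_trans (hn k kN).
  apply: (le_supnorm (f := jet (F n) k \- g k) (M := M1 + M2)) => // w Kw /=.
  by apply: le_trans (ncB _ _) _; rewrite lerD ?hM2 //; exact: hM1.
have -> : g k z - jet r k z = (jet (F n) k z - jet r k z) - (jet (F n) k z - g k z) by ring.
by apply: le_trans (ncB _ _) _; lra.
Qed.
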